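(* With the notation of the context (the normal form Hamiltonian $H^{(1)}$ of the finite periodic Klein--Gordon chain, the dNLS Hamiltonian $K_{\rm eff}$, the thresholds $\epsilon_*$, $\rho_*$, and the constant $\kappa_0$), let $\epsilon\in(0,\epsilon_* )$ and $0<\rho<\rho_*$. Let $z(t)$ be the solution of Hamilton's equations of $H^{(1)}$ with $z(0)=z_0$, let $z_a(t)$ be a solution of Hamilton's equations of $K_{\rm eff}$, and set $\delta(t):=z(t)-z_a(t)$, $\delta_0:=\delta(0)$. (i) Consider the two independent parameters $\rho$ and $\epsilon$ in the regime $\epsilon^2\ll\rho\leq\epsilon$. Then there exists a positive constant $\mathsf{C}$ independent of $\rho$ and $\epsilon$ such that for any initial datum $z_0\in B_{\frac23\rho^{1/2}}$ with $\|\delta_0\|\leq\rho^{-1/2}\epsilon^2$, $$\|\delta(t)\|\leq\mathsf{C}\,\rho^{-1/2}\epsilon^2,\qquad |t|\leq T_0:=\frac1\rho.$$ (ii) Let $\alpha\in(0,1)$ be arbitrary and consider the two independent parameters $\rho$ and $\epsilon$ in the regime $\epsilon^{\frac{2}{1+\alpha}}\ll\rho\leq\epsilon$. Then there exists a positive constant $\mathsf{C}$ independent of $\rho$ and $\epsilon$ such that for any initial datum $z_0\in B_{\frac23\rho^{1/2}}$ with $\|\delta_0\|\leq\rho^{-1/2}\epsilon^2$, $$\|\delta(t)\|\leq\mathsf{C}\,\rho^{-1/2-\alpha}\epsilon^2,\qquad |t|\leq T_0^*:=\frac{\alpha}{\kappa_0\rho}\ln\left(\frac1\rho\right).$$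
   Context: **Asymptotic notation.** For the positive parameters $\rho,\epsilon$, $f\ll g$ means that $f/g$ is sufficiently small (below a threshold independent of $\rho,\epsilon$). **The chain.** Fix $N\geq1$. The finite periodic discrete Klein--Gordon chain has Hamiltonian $H=H_0+H_1$, $$H_0=\tfrac12\sum_{j=-N}^N\left[y_j^2+x_j^2-2\epsilon x_{j+1}x_j\right],\qquad H_1=\tfrac14\sum_{j=-N}^Nx_j^4,$$ with periodic boundary conditions (indices mod $2N+1$), in canonical variables $(x,y)\in\mathbb{R}^{2(2N+1)}$. The phase space carries the Euclidean norm $\|\cdot\|$, and $B_R$ is the ball of radius $R$ centred at $0$. **Seeds and norms.** Let $\tau$ be the cyclic permutation $\tau(x_{-N},\dots,x_N)=(x_{-N+1},\dots,x_N,x_{-N})$, acting on functions by $(\tau f)(x,y)=f(\tau x,\tau y)$. For a function $f$ (a seed) put $f^\oplus:=\sum_{l=-N}^N\tau^lf$; such functions are cyclically symmetric. A seed $f$ is centered aligned if $f=\sum_{m=0}^Nf^{(m)}$ with $f^{(m)}$ depending only on variables with index in $\{-m,\dots,m\}$. For a homogeneous polynomial, $\|f\|$ denotes the sum of absolute values of its coefficients. A centered aligned seed $f$ is of class $\mathcal{D}(C_f,\mu)$, with $C_f>0$ and $0<\mu<1$, if $\|f^{(m)}\|\leq C_f\mu^m$ for $m=0,\dots,N$. **Linear transformation.** Let $A=\mathbb{I}-\epsilon(\tau+\tau^\top)$, where $\tau$ also denotes the permutation matrix, $\tau_{ij}=\delta_{i,j+1\,({\rm mod}\,2N+1)}$.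 In the canonical variables $q=A^{1/4}x$, $p=A^{-1/4}y$ one has $H_0=\frac12p^\top A^{1/2}p+\frac12q^\top A^{1/2}q=H_\Omega+Z_0$, where $H_\Omega=\frac{\Omega}{2}\sum_j(q_j^2+p_j^2)$, $\Omega=(A^{1/2})_{11}$ is the average of the normal-mode frequencies (eigenvalues of $A^{1/2}$), and $Z_0$ is the off-diagonal part, with centered aligned seed $\zeta_0=\sum_{m=1}^N\zeta_0^{(m)}$ of class $\mathcal{D}(C_{\zeta_0},2\epsilon)$, where $\zeta_0^{(m)}$ carries the coupling between sites at distance $m$, with coefficient $b_m:=(A^{1/2})_{1,m+1}=O(\epsilon^m)$. In these variables $H_1=h_1^\oplus$ with a centered aligned seed $h_1$ of class $\mathcal{D}(C_{h_1},2\epsilon)$. **Thresholds.** Let $$f(\epsilon)=\frac{3\Omega}{64C_{\zeta_0}}\,\frac{(1-2\epsilon)\left[1-(2\epsilon)^{3/4}\right]}{\sqrt{2\epsilon}}.$$ The number $\epsilon_*<\frac12$ is such that $f(\epsilon)>1$ for $\epsilon\in(0,\epsilon_* )$. Put $$\gamma=2\Omega\left(1-\frac1{2f(\epsilon)}\right),\qquad C_*=\frac{4C_{h_1}}{3\gamma(1-2\epsilon)\left[1-(2\epsilon)^{3/4}\right]},\qquad \rho_*=\frac1{96(1+e)C_*}.$$ **Normal form (known fact).** For $\epsilon\in(0,\epsilon_* )$ there is a cyclically symmetric generating function $\mathcal{X}_1$ whose Lie transform $T_{\mathcal{X}_1}$ satisfies $T_{\mathcal{X}_1}H^{(1)}=H$,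 with $$H^{(1)}=H_\Omega+Z_0+Z_1+P^{(2)},\qquad \{H_\Omega,Z_0\}=\{H_\Omega,Z_1\}=0,$$ where $Z_1=\zeta_1^\oplus$ is a quartic polynomial with seed $\zeta_1=\sum_{m=0}^N\zeta_1^{(m)}$ of class $\mathcal{D}(C_{h_1},2\epsilon)$. For $0<\rho<\rho_*$, $T_{\mathcal{X}_1}$ defines an analytic canonical transformation on $B_{\frac23\rho^{1/2}}$, with $\|T_{\mathcal{X}_1}^{\pm1}(z)-z\|\leq4^4C_*\rho^{3/2}$ for $z$ in that ball. The remainder $P^{(2)}=\sum_{s\geq2}H^{(1)}_s$ is analytic there; each $H_s^{(1)}$ is a cyclically symmetric homogeneous polynomial of degree $2s+2$ with seed of class $\mathcal{D}(2\tilde C_*^{\,s-1}C_{h_1},\sqrt{2\epsilon})$ for a constant $\tilde C_*$. This $H^{(1)}$ is the one used in the claim. **The dNLS Hamiltonian.** Put $Z_0^{(m)}=(\zeta_0^{(m)})^\oplus$ and $Z_1^{(m)}=(\zeta_1^{(m)})^\oplus$. The effective Hamiltonian $K_{\rm eff}:=H_\Omega+Z_0^{(1)}+Z_1^{(0)}$ keeps the leading order in $\epsilon$ of $Z_0$ and $Z_1$. In complex coordinates $\psi_j=(q_j+ip_j)/\sqrt2$ it reads $$K_{\rm eff}=(\Omega+2b_1)\sum_j|\psi_j|^2-b_1\sum_j|\psi_{j+1}-\psi_j|^2+\frac38\sum_j|\psi_j|^4,$$ and its equations of motion are $i\dot\psi_j=\Omega\psi_j+b_1(\psi_{j+1}+\psi_{j-1})+\frac34\psi_j|\psi_j|^2$.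 **The constant $\kappa_0$.** Let $X_N$ be the Hamiltonian vector field of $Z_1+P^{(2)}$. There is a constant $\mathsf{C}_1$, independent of $\rho$ and $\epsilon$, such that the norm of its differential $X_N'$ at points of norm of order $\rho^{1/2}$ is at most $\mathsf{C}_1C_{h_1}\rho/(1-(2\epsilon)^{1/4})^2$. Put $\kappa_0:=\mathsf{C}_1C_{h_1}/(1-(2\epsilon_* )^{1/4})^2$. *)

(* Defs.v *)
(* MathComp / MathComp-Analysis.  Only the canonical structures of [mpoly] are
   imported: its notations clash with those of MathComp-Analysis. *)
From HB Require Import structures.
From mathcomp Require Import all_boot all_order all_algebra.
From mathcomp Require Import all_classical all_reals all_analysis.
From mathcomp Require mpoly.
Import (canonicals) mpoly.

Set Implicit Arguments.
Unset Strict Implicit.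
Unset Printing Implicit Defensive.

Import Order.TTheory GRing.Theory Num.Theory.
Import numFieldNormedType.Exports.

Local Open Scope classical_set_scope.
Local Open Scope ring_scope.

(* The sites -N, ..., N are represented by their residues mod 2N+1 in
   'I_(2N+1); the site -k is therefore the ordinal 2N+1-k.  [ordS] is the
   cyclic successor.  A point of the phase space is the row (q, p): the
   coordinate q_j has index [lshift _ j], and p_j has index [rshift _ j]. *)
Notation sites N := (N.*2.+1).
Notation phase R N := 'rV[R]_(sites N + sites N).
Notation poly R N := (mpoly.mpoly (sites N + sites N) R).

Notation qidx N j := (lshift (sites N) (j : 'I_(sites N))).
Notation pidx N j := (rshift (sites N) (j : 'I_(sites N))).

Notation var R N i :=
  (mpoly.mpolyX R (mpoly.mnm1 (i : 'I_(sites N + sites N))) : poly R N).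
Notation qvar R N j := (var R N (qidx N j)).
Notation pvar R N j := (var R N (pidx N j)).

Definition enorm (R : realType) (N : nat) (z : phase R N) : R :=
  Num.sqrt (\sum_i z 0 i ^+ 2).

Definition cball (R : realType) (N : nat) (r : R) : set (phase R N) :=
  [set z | enorm z <= r].

Definition peval (R : realType) (N : nat) (f : poly R N) (z : phase R N) : R :=
  mpoly.meval (fun i => z 0 i) f.

(** Hamiltonian formalism *)

Definition partial (R : realType) (N : nat) (i : 'I_(sites N + sites N))
    (F : phase R N -> R) (z : phase R N) : R :=
  'D_(delta_mx 0 i) F z.

Definition hamvf (R : realType) (N : nat) (F : phase R N -> R) (z : phase R N)
    : phase R N :=
  row_mx (\row_j partial (pidx N j) F z) (- \row_j partial (qidx N j) F z).

Definition fbracket (R : realType) (N : nat) (F G : phase R N -> R)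
    (z : phase R N) : R :=
  \sum_j (partial (qidx N j) F z * partial (pidx N j) G z
          - partial (pidx N j) F z * partial (qidx N j) G z).

Definition pbracket (R : realType) (N : nat) (f g : poly R N) : poly R N :=
  \sum_j (mpoly.mderiv (qidx N j) f * mpoly.mderiv (pidx N j) g
          - mpoly.mderiv (pidx N j) f * mpoly.mderiv (qidx N j) g).

(* Solutions live on open intervals around the time 0, so that every maximal
   solution is covered. *)
Definition time_interval (R : realType) (J : set R) : Prop :=
  [/\ open J, is_interval J & J 0].

Definition hamilton_solution (R : realType) (N : nat) (D : set (phase R N))
    (F : phase R N -> R) (J : set R) (z : R -> phase R N) : Prop :=
  forall t, J t -> D (z t) /\ is_derive t 1 z (hamvf F (z t)).

(** Seeds *)

(* (tau f)(x, y) = f (tau x, tau y), where (tau x)_j = x_(j+1). *)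
Definition shift_idx (N : nat) (i : 'I_(sites N + sites N)) :
    'I_(sites N + sites N) :=
  match fintype.split i with
  | inl j => qidx N (ordS j)
  | inr j => pidx N (ordS j)
  end.

Definition tau (R : realType) (N : nat) (f : poly R N) : poly R N :=
  mpoly.comp_mpoly [tuple var R N (shift_idx i) | i < sites N + sites N] f.

(* Since tau has order 2N+1, l may run over 0..2N instead of -N..N. *)
Definition cyc (R : realType) (N : nat) (f : poly R N) : poly R N :=
  \sum_(l < sites N) iter l (@tau R N) f.

(* j is in {-m, ..., m} mod 2N+1. *)
Definition in_window (N m : nat) (j : 'I_(sites N)) : bool :=
  (j <= m)%N || (sites N - j <= m)%N.

Definition supported_in_window (R : realType) (N m : nat) (f : poly R N) :
    Prop :=
  forall mon, mon \in mpoly.msupp f -> forall j, ~~ in_window m j ->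
    mpoly.fun_of_multinom mon (qidx N j) = 0%N /\
    mpoly.fun_of_multinom mon (pidx N j) = 0%N.

Definition coeff_norm (R : realType) (N : nat) (f : poly R N) : R :=
  \sum_(mon <- mpoly.msupp f) `|mpoly.mcoeff mon f|.

Definition homogeneous (R : realType) (N : nat) (d : nat) (f : poly R N) : bool :=
  f \is mpoly.ishomog1 d (mpoly.Measure.clone _ (@mpoly.mdeg _) _).

(* A centered aligned seed is given by its components f^(0), ..., f^(N). *)
Definition seed (R : realType) (N : nat) := nat -> poly R N.

Definition seed_sum (R : realType) (N : nat) (f : seed R N) : poly R N :=
  \sum_(m < N.+1) f m.

Definition classD (R : realType) (N d : nat) (C mu : R) (f : seed R N) : Prop :=
  [/\ 0 < C, 0 < mu < 1 &
      forall m, (m <= N)%N ->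
        [/\ homogeneous d (f m), supported_in_window m (f m)
          & coeff_norm (f m) <= C * mu ^+ m]].

(** The Klein-Gordon chain *)

Definition H0xy (R : realType) (N : nat) (eps : R) : poly R N :=
  (2^-1 : R) *: \sum_j (pvar R N j ^+ 2 + qvar R N j ^+ 2
                 - (2 * eps) *: (qvar R N (ordS j) * qvar R N j)).

Definition H1xy (R : realType) (N : nat) : poly R N :=
  (4^-1 : R) *: \sum_j qvar R N j ^+ 4.

Definition tau_mx (R : realType) (N : nat) : 'M[R]_(sites N) :=
  \matrix_(i, j) (i == ordS j)%:R.

Definition A (R : realType) (N : nat) (eps : R) : 'M[R]_(sites N) :=
  1%:M - eps *: (tau_mx R N + (tau_mx R N)^T).

(* The positive semidefinite square root of a symmetric positive semidefinite
   matrix (0 by convention if there is none). *)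
Definition is_mxsqrt (R : realType) (n : nat) (M S : 'M[R]_n) : Prop :=
  [/\ S^T = S, (forall v : 'cV[R]_n, 0 <= (v^T *m S *m v) 0 0) & S *m S = M].

Definition mxsqrt (R : realType) (n : nat) (M : 'M[R]_n) : 'M[R]_n :=
  xget 0 [set S | is_mxsqrt M S].

Definition A12 (R : realType) (N : nat) (eps : R) := mxsqrt (A N eps).
Definition A14 (R : realType) (N : nat) (eps : R) := mxsqrt (A12 N eps).

(* Substitution of x = A^(-1/4) q, y = A^(1/4) p. *)
Definition to_qp (R : realType) (N : nat) (eps : R) (f : poly R N) : poly R N :=
  mpoly.comp_mpoly
    [tuple match fintype.split i with
           | inl j => \sum_k invmx (A14 N eps) j k *: qvar R N k
           | inr j => \sum_k A14 N eps j k *: pvar R N k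
           end | i < sites N + sites N] f.

Definition Omega (R : realType) (N : nat) (eps : R) : R := A12 N eps 0 0.
Definition bcoef (R : realType) (N : nat) (eps : R) (m : nat) : R :=
  A12 N eps 0 (inord m).

Definition HOmega (R : realType) (N : nat) (eps : R) : poly R N :=
  (Omega N eps / 2) *: \sum_j (qvar R N j ^+ 2 + pvar R N j ^+ 2).

(* zeta_0^(m)^oplus = sum_j b_m (q_j q_(j+m) + p_j p_(j+m)): for 1 <= m <= N
   each pair of sites at distance m occurs once. *)
Definition zeta0 (R : realType) (N : nat) (eps : R) : seed R N :=
  fun m => if m == 0%N then 0 else
    bcoef N eps m *: (qvar R N 0 * qvar R N (inord m)
                      + pvar R N 0 * pvar R N (inord m)).

Definition Z0 (R : realType) (N : nat) (eps : R) : poly R N :=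
  cyc (seed_sum (zeta0 N eps)).

(** Thresholds *)

Definition f_thr (R : realType) (N : nat) (Czeta0 eps : R) : R :=
  3 * Omega N eps / (64 * Czeta0) *
  ((1 - 2 * eps) * (1 - (2 * eps) `^ (3 / 4)) / Num.sqrt (2 * eps)).

Definition gamma (R : realType) (N : nat) (Czeta0 eps : R) : R :=
  2 * Omega N eps * (1 - 1 / (2 * f_thr N Czeta0 eps)).

Definition Cstar (R : realType) (N : nat) (Czeta0 Ch1 eps : R) : R :=
  4 * Ch1 / (3 * gamma N Czeta0 eps * (1 - 2 * eps) *
             (1 - (2 * eps) `^ (3 / 4))).

Definition rho_star (R : realType) (N : nat) (Czeta0 Ch1 eps : R) : R :=
  1 / (96 * (1 + expR 1) * Cstar N Czeta0 Ch1 eps).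

(** Normal form *)

(* Real analyticity at z0: F is, near z0, the sum of an absolutely convergent
   power series, grouped by degree. *)
Definition analytic_at (R : realType) (N : nat) (F : phase R N -> R)
    (z0 : phase R N) : Prop :=
  exists (r : R) (P : nat -> poly R N),
    [/\ 0 < r, forall k, homogeneous k (P k),
        cvgn (series (fun k => coeff_norm (P k) * r ^+ k)) &
        forall z : phase R N, (forall i, `|z 0 i - z0 0 i| < r) ->
          series (fun k => peval (P k) (z - z0)) @ \oo --> F z].

(* [gen] is the (quartic) generating function chi of the Lie transform,
   [zeta1] the seed of Z_1, and [eta s] the seed of H^(1)_s for s >= 2. *)
Record nf_data (R : realType) (N : nat) := NFData {
  gen : poly R N;
  zeta1 : seed R N;
  eta : nat -> seed R N }.

(* The homogeneous components of H^(1); [Hnf s] has degree 2s+2. *)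
Definition Hnf (R : realType) (N : nat) (eps : R) (nf : nf_data R N) (s : nat)
    : poly R N :=
  match s with
  | 0%N => HOmega N eps + Z0 N eps
  | 1%N => cyc (seed_sum (zeta1 nf))
  | _ => cyc (seed_sum (eta nf s))
  end.

Definition P2 (R : realType) (N : nat) (eps : R) (nf : nf_data R N)
    (z : phase R N) : R :=
  limn (fun n => \sum_(2 <= s < n) peval (Hnf eps nf s) z).

Definition H1nf (R : realType) (N : nat) (eps : R) (nf : nf_data R N)
    (z : phase R N) : R :=
  peval (HOmega N eps + Z0 N eps + cyc (seed_sum (zeta1 nf))) z + P2 eps nf z.

(* T_chi = exp(L_chi) with L_chi = {chi, .}; the opposite convention for L
   amounts to replacing chi by -chi.  Since chi has degree 4, L_chi raises the
   degree by 2, and this is the component of degree 2s+2 of T_chi (sum_s f_s)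
   for f_s homogeneous of degree 2s+2. *)
Definition lie_transform (R : realType) (N : nat) (chi : poly R N)
    (f : nat -> poly R N) (s : nat) : poly R N :=
  \sum_(k < s.+1) (k`!%:R^-1 : R) *: iter k (pbracket chi) (f (s - k)%N).

Definition lie_coord (R : realType) (N : nat) (chi : poly R N)
    (i : 'I_(sites N + sites N)) (z : phase R N) : R^nat :=
  series (fun k => k`!%:R^-1 * peval (iter k (pbracket chi) (var R N i)) z).

(* The transformation z |-> T_chi z of the phase space, whose components are
   the Lie transforms of the coordinate functions.  Its inverse is given by
   T_chi^{-1} = exp(-L_chi) = exp(L_{-chi}). *)
Definition lie_map (R : realType) (N : nat) (chi : poly R N) (z : phase R N)
    : phase R N :=
  \row_i limn (lie_coord chi i z).

Definition analytic_canonical (R : realType) (N : nat) (B : set (phase R N))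
    (chi : poly R N) : Prop :=
  forall z, B z ->
    [/\ forall i, cvgn (lie_coord chi i z),
        forall i, analytic_at (fun w => lie_map chi w 0 i) z &
        forall i k,
          fbracket (fun w => lie_map chi w 0 i) (fun w => lie_map chi w 0 k) z
          = fbracket (fun w => w 0 i) (fun w => w 0 k) z].

(* The homogeneous components of the original Hamiltonian in (q, p). *)
Definition Hkg (R : realType) (N : nat) (eps : R) (s : nat) : poly R N :=
  match s with
  | 0%N => to_qp eps (H0xy N eps)
  | 1%N => to_qp eps (H1xy R N)
  | _ => 0
  end.

Record normal_form (R : realType) (N : nat) (Czeta0 Ch1 Ctil eps : R)
    (nf : nf_data R N) : Prop := NormalForm {
  nf_gen_homog : homogeneous 4 (gen nf);
  nf_gen_cyclic : tau (gen nf) = gen nf;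
  nf_lie : forall s, lie_transform (gen nf) (Hnf eps nf) s = Hkg N eps s;
  nf_bracket0 : pbracket (HOmega N eps) (Z0 N eps) = 0;
  nf_bracket1 : pbracket (HOmega N eps) (cyc (seed_sum (zeta1 nf))) = 0;
  nf_zeta1 : classD 4 Ch1 (2 * eps) (zeta1 nf);
  (* Z_1^(0) = 3/8 sum_j |psi_j|^4, with |psi_j|^2 = (q_j^2 + p_j^2) / 2 *)
  nf_Z1_leading : cyc (zeta1 nf 0%N) =
    (3 / 8) *: \sum_j ((2^-1 : R) *: (qvar R N j ^+ 2 + pvar R N j ^+ 2)) ^+ 2;
  nf_eta : forall s, (2 <= s)%N ->
    classD (s.*2 + 2)%N (2 * Ctil ^+ s.-1 * Ch1) (Num.sqrt (2 * eps)) (eta nf s);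
  nf_transform : forall rho, 0 < rho < rho_star N Czeta0 Ch1 eps ->
    forall chi, chi = gen nf \/ chi = - gen nf ->
    analytic_canonical (@cball R N (2 / 3 * rho `^ (1 / 2))) chi /\
    forall z : phase R N, enorm z <= 2 / 3 * rho `^ (1 / 2) ->
      enorm (lie_map chi z - z)
        <= 4 ^+ 4 * Cstar N Czeta0 Ch1 eps * rho `^ (3 / 2);
  nf_remainder : forall rho, 0 < rho < rho_star N Czeta0 Ch1 eps ->
    forall z : phase R N, enorm z <= 2 / 3 * rho `^ (1 / 2) ->
      cvgn (fun n => \sum_(2 <= s < n) peval (Hnf eps nf s) z) /\
      analytic_at (P2 eps nf) z }.

(* The union of the balls of radius 2/3 rho^(1/2), rho < rho_star, on which
   H^(1) is defined. *)
Definition nf_domain (R : realType) (N : nat) (Czeta0 Ch1 eps : R) :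
    set (phase R N) :=
  [set z | exists rho, 0 < rho < rho_star N Czeta0 Ch1 eps /\
                       enorm z <= 2 / 3 * rho `^ (1 / 2)].

Definition Keff (R : realType) (N : nat) (eps : R) (nf : nf_data R N) : poly R N :=
  HOmega N eps + cyc (zeta0 N eps 1%N) + cyc (zeta1 nf 0%N).

(** The constant kappa_0 *)

Definition XN (R : realType) (N : nat) (eps : R) (nf : nf_data R N) :
    phase R N -> phase R N :=
  hamvf (fun z => peval (cyc (seed_sum (zeta1 nf))) z + P2 eps nf z).

(* "Points of norm of order rho^(1/2)" are those of norm <= c0 rho^(1/2). *)
Definition XN_differential_bound (R : realType) (N : nat)
    (Czeta0 Ch1 C1 c0 eps : R) (nf : nf_data R N) : Prop :=
  forall rho, 0 < rho < rho_star N Czeta0 Ch1 eps ->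
  forall z, nf_domain Czeta0 Ch1 eps z -> enorm z <= c0 * rho `^ (1 / 2) ->
    differentiable (XN eps nf) z /\
    forall v, enorm ('d (XN eps nf) z v) <=
      C1 * Ch1 * rho / (1 - (2 * eps) `^ (1 / 4)) ^+ 2 * enorm v.

Definition kappa0 (R : realType) (Ch1 C1 eps_star : R) : R :=
  C1 * Ch1 / (1 - (2 * eps_star) `^ (1 / 4)) ^+ 2.

(** The approximation estimate *)

(* For every initial datum z0 in the ball of radius 2/3 rho^(1/2), the solution
   z of the equations of H^(1) issued from z0 exists for |t| <= T, and every
   solution z_a of the equations of K_eff whose initial distance from z0 is at
   most rho^(-1/2) eps^2 satisfies |z - z_a| <= bound for |t| <= T. *)
Definition approximates (R : realType) (N : nat) (Czeta0 Ch1 eps rho T bound : R)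
    (nf : nf_data R N) : Prop :=
  let sol := hamilton_solution (nf_domain Czeta0 Ch1 eps) (H1nf eps nf) in
  forall z0 : phase R N, enorm z0 <= 2 / 3 * rho `^ (1 / 2) ->
  (exists J z, [/\ time_interval J, `[- T, T] `<=` J, sol J z & z 0 = z0]) /\
  (forall J z za,
     time_interval J -> sol J z -> z 0 = z0 ->
     hamilton_solution setT (peval (Keff eps nf)) J za ->
     enorm (z 0 - za 0) <= rho `^ (- (1 / 2)) * eps ^+ 2 ->
     forall t, J t -> `|t| <= T -> enorm (z t - za t) <= bound).

(* Main.v *)
From HB Require Import structures.
From mathcomp Require Import all_boot all_order all_algebra.
From mathcomp Require Import all_classical all_reals all_analysis.
From mathcomp Require Import ring lra.
From mathcomp Require mpoly.
Import (canonicals) mpoly.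
Require Import Defs.

Set Implicit Arguments.
Unset Strict Implicit.
Unset Printing Implicit Defensive.

Import Order.TTheory GRing.Theory Num.Theory.
Import numFieldNormedType.Exports.

Local Open Scope classical_set_scope.
Local Open Scope ring_scope.

(** Let [L] be the linear vector field of [HOmega + Z_0], [X_N] the vector field of
    [Z_1 + P2], and [d = z - z_a]. Then
    [[
      d' = L d + (X_N z - X_N z_a) + r,
    ]]
    where the residual [r] is the vector field of [H^(1) - Keff] along [z_a].
    The field [L] is skew for the Euclidean product, because every term of
    [HOmega + Z_0] is a combination of [Re (psi_i conj psi_j)] and hence gauge
    invariant. The differential of [X_N] is at most [kappa_0 rho]. The residual is
    [O(eps^2 rho^(1/2))], as [rho <= eps] ([residual_le]). Therefore
    [|d|' <= kappa_0 rho |d| + O(eps^2 rho^(1/2))], and Gronwall's inequality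
    ([gronwall_sqrt]) gives
    [[
      |d t| <= exp (kappa_0 rho |t|) (1 + O(1)) rho^(-1/2) eps^2,
    ]]
    see [one_sided_estimate]. The exponential is [exp kappa_0] at the time
    [1 / rho], and [rho^(-alpha)] at the time [alpha ln (1 / rho) / (kappa_0 rho)].

    The exponent of the second regime leaves no room for a loss in [kappa_0]: both
    orbits must remain in the ball of radius [c0 rho^(1/2)], where [c0] is only
    known to exceed 2/3. For [z_a] this holds because gauge invariance of [Keff]
    conserves its norm. For [z] it follows from the conservation of [H^(1)], which
    differs from [Omega |z|^2 / 2] by [O(eps rho)] ([H_energy]), and from a
    continuity argument ([confinement]). This needs [eps / Omega] to be small; now
    the threshold [f > 1] implies that [Omega] and [rho_star] are at least of order
    [eps^(1/2)] ([Omega_lower_bound], [rho_star_lower_bound]), whereas both regimes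
    force [rho <= eps] and [eps] to be small.

    Confinement also gives existence: the vector field is frozen outside a cube,
    the resulting Lipschitz field has global solutions ([picard_global]), and these
    never leave the region where the field is unchanged ([global_solution]).

    The bounds on the polynomials and on the remainder, a series of homogeneous
    polynomials, are obtained as Lipschitz constants on cubes ([lips]) computed from
    the coefficients of the seeds ([classD_lips], [P2_lipschitz]); as a Lipschitz
    constant bounds the gradient ([hamvf_le]), the series is never differentiated
    term by term. *)

(** * Real functions of one variable *)

Section OneVariable.
Context {R : realType}.
Implicit Types (f df : R -> R) (a b t T : R).

Lemma is_derive_continuous_within f df a b :
  (forall x, a <= x <= b -> is_derive x 1 f (df x)) ->
  {within `[a, b], continuous f}.
Proof.
move=> fdf; apply: derivable_within_continuous => x.
by rewrite in_itv /= => /fdf[].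
Qed.

Lemma le0_is_derive_le f df a b : a <= b ->
  (forall x, a <= x <= b -> is_derive x 1 f (df x)) ->
  (forall x, a <= x <= b -> df x <= 0) -> f b <= f a.
Proof.
move=> ab fdf df0.
have [||c] := @MVT_segment _ f df a b ab.
- by move=> x; rewrite in_itv /= => /andP[/ltW ax /ltW xb]; apply: fdf; rewrite ax.
- exact: is_derive_continuous_within fdf.
rewrite in_itv /= => /df0 dfc E.
rewrite -subr_le0 E; apply: mulr_le0_ge0 => //; by rewrite subr_ge0.
Qed.

Lemma is_derive_reflect (V : normedModType R) (f : R -> V) (t : R) (df : V) :
  is_derive (- t) 1 f df -> is_derive t 1 (fun s => f (- s)) (- df).
Proof.
move=> [fd <-].
have df1 : differentiable f (- t) by exact/derivable1_diffP.
have dN : is_derive t (1 : R) (-%R : R -> R) (- 1) by exact: is_deriveNid.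
have d2 : differentiable (-%R : R -> R) t by exact/derivable1_diffP.
have dc : differentiable (f \o -%R) t by exact: differentiable_comp.
split; first exact/derivable1_diffP.
rewrite deriveE // diff_comp //=.
have -> : 'd (-%R : R -> R) t 1 = - 1 by rewrite -deriveE // derive_val.
by rewrite linearN /= -deriveE.
Qed.

Lemma is_derive_expRM (l t : R) :
  is_derive t 1 (fun s => expR (l * s)) (l * expR (l * t)).
Proof.
have h1 : is_derive t 1 (fun s => l * s) l.
  have h := is_deriveZ l (is_derive_id t (1 : R)).
  by apply: (is_derive_eq h); rewrite /GRing.scale /= mulr1.
have h := @is_derive1_comp R expR (fun s => l * s) t _ _ (is_derive_expR _) h1.
by apply: (is_derive_eq h); rewrite mulrC.
Qed.

(** Formally [(sqrt phi)' <= k sqrt phi + c], and Gronwall's inequality applies.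
    To stay away from the singularity of the square root, [phi] is replaced by
    [phi + s ^ 2], and [s] then tends to 0. *)
Lemma gronwall_sqrt (phi dphi : R -> R) (k c T : R) :
  0 < k -> 0 <= c -> 0 <= T ->
  (forall t, 0 <= t <= T -> is_derive t 1 phi (dphi t)) ->
  (forall t, 0 <= t <= T -> 0 <= phi t) ->
  (forall t, 0 <= t <= T ->
    dphi t <= 2 * (k * phi t + c * Num.sqrt (phi t))) ->
  Num.sqrt (phi T) <= expR (k * T) * (Num.sqrt (phi 0) + c / k).
Proof.
move=> k0 c0 T0 dph ph0 dle.
have approx (s : R) : 0 < s ->
    Num.sqrt (phi T) <= expR (k * T) * (Num.sqrt (phi 0) + s + c / k).
  move=> s0.
  pose N t := Num.sqrt (phi t + s ^+ 2).
  pose g t := expR (- k * t) * (N t + c / k).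
  pose dg t := expR (- k * t) * (dphi t / (2 * N t))
               + (N t + c / k) * (expR (- k * t) * - k).
  have Npos t : 0 <= t <= T -> 0 < N t.
    by move=> tT; rewrite sqrtr_gt0 ltr_wpDl ?ph0 // exprn_gt0.
  have gder t : 0 <= t <= T -> is_derive t 1 g (dg t).
    move=> tT; have phit := ph0 _ tT.
    have h1 : is_derive t 1 phi (dphi t) := dph _ tT.
    have p0 : 0 < phi t + s ^+ 2 by rewrite ltr_wpDl // exprn_gt0.
    have h2 : is_derive t 1 N (dphi t / (2 * N t)).
      have h3 : is_derive (phi t + s ^+ 2) 1 (@Num.sqrt R) (2 * N t)^-1
        by exact: is_derive1_sqrt.
      have h4 : is_derive t 1 (fun x => phi x + s ^+ 2) (dphi t).
        by apply: is_derive_eq; rewrite addr0.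
      have h5 := @is_derive1_comp R _ (fun x => phi x + s ^+ 2) t _ _ h3 h4.
      by rewrite mulrC.
    have h6 := is_derive_expRM (- k) t.
    have h7 : is_derive t 1 (fun x => N x + c / k) (dphi t / (2 * N t)).
      by apply: is_derive_eq; rewrite addr0.
    rewrite /g /dg; apply: (is_derive_eq (is_deriveM h6 h7)).
    by rewrite /GRing.scale /=; ring.
  have dg0 t : 0 <= t <= T -> dg t <= 0.
    move=> tT; have Nt := Npos _ tT.
    have -> : dg t = expR (- k * t) * (dphi t / (2 * N t) - k * (N t + c / k)).
      by rewrite /dg; ring.
    rewrite pmulr_rle0 ?expR_gt0 // subr_le0.
    have NN : N t * N t = phi t + s ^+ 2.
      by rewrite -expr2 sqr_sqrtr // addr_ge0 ?ph0 // sqr_ge0.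
    have sN : Num.sqrt (phi t) <= N t by rewrite ler_wsqrtr // lerDl sqr_ge0.
    have H : dphi t / (2 * N t) <= k * N t + c.
      rewrite ler_pdivrMr ?mulr_gt0 //; apply: (le_trans (dle _ tT)).
      have -> : (k * N t + c) * (2 * N t) = 2 * (k * (N t * N t) + c * N t) by ring.
      rewrite NN ler_pM2l // lerD //; last exact: ler_wpM2l.
      by rewrite ler_pM2l // lerDl sqr_ge0.
    by have -> : k * (N t + c / k) = k * N t + c by field; rewrite gt_eqF.
  have := le0_is_derive_le T0 gder dg0.
  rewrite /g mulr0 expR0 mul1r => gle.
  have TT : 0 <= T <= T by rewrite T0 lexx.
  have : N T + c / k <= expR (k * T) * (N 0 + c / k).
    rewrite -(@ler_pM2l _ (expR (- k * T))) ?expR_gt0 //.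
    by rewrite mulrA -expRD mulNr addNr expR0 mul1r -mulNr.
  have sT : Num.sqrt (phi T) <= N T + c / k.
    rewrite -[leLHS]addr0 lerD //; first by rewrite ler_wsqrtr // lerDl sqr_ge0.
    by rewrite divr_ge0 // ltW.
  have s00 : N 0 <= Num.sqrt (phi 0) + s.
    have p0 : 0 <= phi 0 by apply: ph0; rewrite lexx.
    rewrite -(@ler_pXn2r _ 2) ?nnegrE ?addr_ge0 ?sqrtr_ge0 ?(ltW s0) //.
    rewrite sqr_sqrtr; last by rewrite addr_ge0 // sqr_ge0.
    rewrite sqrrD sqr_sqrtr // lerD2r lerDl.
    by rewrite mulrn_wge0 // mulr_ge0 ?sqrtr_ge0 // ltW.
  move=> H; apply: (le_trans sT); apply: (le_trans H).
  by rewrite ler_pM2l ?expR_gt0 // lerD2r.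
apply/ler_addgt0Pr => e e0.
have ek : 0 < e / expR (k * T) by rewrite divr_gt0 // expR_gt0.
apply: (le_trans (approx _ ek)).
rewrite !mulrDr; have -> : expR (k * T) * (e / expR (k * T)) = e.
  by rewrite mulrC divfK // gt_eqF // expR_gt0.
by lra.
Qed.

(** An exponential envelope reproduces itself under integration, with the gain
    of a factor [1 / l]. *)
Lemma exp_envelope f df (B l : R) : 0 < l ->
  f 0 = 0 -> (forall t, is_derive t 1 f (df t)) ->
  (forall t, `|df t| <= B * expR (l * `|t|)) ->
  forall t, `|f t| <= B / l * expR (l * `|t|).
Proof.
move=> l0 f0 fdf dfB.
have B0 : 0 <= B.
  have := dfB 0; rewrite normr0 mulr0 expR0 mulr1; exact: le_trans.
have main (h dh : R -> R) : h 0 = 0 -> (forall t, is_derive t 1 h (dh t)) ->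
    (forall t, 0 <= t -> `|dh t| <= B * expR (l * t)) ->
    forall t, 0 <= t -> h t <= B / l * expR (l * t).
  move=> h0 hdh dhB t t0.
  pose g s := h s - B / l * expR (l * s).
  pose dg s := dh s - B * expR (l * s).
  have gd x : 0 <= x <= t -> is_derive x 1 g (dg x).
    move=> _; have hx := hdh x; have he := is_derive_expRM l x.
    apply: (is_derive_eq (is_deriveB hx (is_deriveZ (B / l) he))).
    by rewrite /dg /GRing.scale /=; field; rewrite gt_eqF.
  have dg0 x : 0 <= x <= t -> dg x <= 0.
    by move=> /andP[x0 _]; rewrite subr_le0 (le_trans (ler_norm _)) // dhB.
  have := le0_is_derive_le t0 gd dg0.
  have Bl : 0 <= B / l by rewrite divr_ge0 // ltW.
  by rewrite /g h0 mulr0 expR0; lra.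
have main2 (h dh : R -> R) : h 0 = 0 -> (forall t, is_derive t 1 h (dh t)) ->
    (forall t, 0 <= t -> `|dh t| <= B * expR (l * t)) ->
    forall t, 0 <= t -> `|h t| <= B / l * expR (l * t).
  move=> h0 hdh dhB t t0; rewrite ler_norml (main _ _ h0 hdh dhB) // andbT lerNl.
  apply: (main (fun s => - h s) (fun s => - dh s)) => //.
  - by rewrite h0 oppr0.
  - by move=> s s0; rewrite normrN dhB.
move=> t; have [t0|t0] := leP 0 t.
  rewrite (ger0_norm t0); apply: (main2 f df f0 fdf _ t t0) => s s0.
  by have := dfB s; rewrite (ger0_norm s0).
rewrite (ltr0_norm t0) -[t in f t]opprK.
apply: (main2 (fun s => f (- s)) (fun s => - df (- s))).
- by rewrite oppr0.
- by move=> s; apply: is_derive_reflect.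
- by move=> s s0; have := dfB (- s); rewrite !normrN (ger0_norm s0).
- by rewrite oppr_ge0 ltW.
Qed.

(** The intervals of centre [a k] and radius [2 C / 2 ^ k] are nested; the limit
    is the supremum of their lower ends. *)
Lemma geometric_steps_limit (a : nat -> R) (C : R) : 0 <= C ->
  (forall k, `|a k.+1 - a k| <= C / 2 ^+ k) ->
  exists l, forall k, `|l - a k| <= 2 * C / 2 ^+ k.
Proof.
move=> C0 ha.
pose c k := 2 * C / 2 ^+ k.
have cS k : c k.+1 = C / 2 ^+ k.
  rewrite /c exprS; field; by rewrite expf_neq0.
have cc k : c k = c k.+1 + c k.+1 by rewrite cS /c; field; rewrite expf_neq0.
have c0 k : 0 <= c k by rewrite divr_ge0 // ?mulr_ge0 // exprn_ge0.
have lo j m : a j - c j <= a (j + m)%N - c (j + m)%N.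
  elim: m => [|m IH]; first by rewrite addn0.
  apply: (le_trans IH); rewrite addnS.
  have := ha (j + m)%N; rewrite -cS ler_norml => /andP[h1 h2].
  have := cc (j + m)%N; move: h1; lra.
have hi j m : a (j + m)%N + c (j + m)%N <= a j + c j.
  elim: m => [|m IH]; first by rewrite addn0.
  apply: le_trans IH; rewrite addnS.
  have := ha (j + m)%N; rewrite -cS ler_norml => /andP[h1 h2].
  have := cc (j + m)%N; move: h2; lra.
have lohi i j : a i - c i <= a j + c j.
  have h1 := lo i j; have h2 := hi j i; rewrite addnC in h2.
  have := c0 (i + j)%N; lra.
pose E := [set x | exists k, x = a k - c k].
have supE : has_sup E.
  split; first by exists (a 0%N - c 0%N), 0%N.
  by exists (a 0%N + c 0%N) => _ [k ->].
exists (sup E) => k; rewrite ler_norml; apply/andP; split.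
  have : a k - c k <= sup E by apply: ub_le_sup; [exact: supE.2|exists k].
  rewrite /c; lra.
have : sup E <= a k + c k by apply: ge_sup; [exact: supE.1|move=> _ [j ->]].
rewrite /c; lra.
Qed.

(** The integrals from [- m] to [x], normalized to vanish at 0, agree for all [m]
    large enough, and thus glue to a primitive on the whole line. *)
Lemma primitive_exists f : continuous f ->
  exists F : R -> R, F 0 = 0 /\ forall t, is_derive t 1 F (f t).
Proof.
move=> cf.
pose G (m : nat) (x : R) :=
  (\int[lebesgue_measure]_(t in [set` `[- (m%:R), x]]) f t)%R.
have Gd (m : nat) (x : R) : - m%:R < x -> is_derive x 1 (G m) (f x).
  move=> mx.
  have [||d e] := @continuous_FTC1_closed R f (- m%:R) x (x + 1) _ _ mx (cf x).
  - by rewrite ltrDl.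
  - apply: continuous_compact_integrable; first exact: segment_compact.
    exact: continuous_subspaceT.
  - by split => //; rewrite -derive1E.
have Gconst (m p : nat) (x y : R) : (m <= p)%N -> - m%:R < x -> x <= y ->
    G m y - G m x = G p y - G p x.
  move=> mp mx xy.
  have mp' : - p%:R <= - m%:R :> R by rewrite lerN2 ler_nat.
  pose h t := G m t - G p t.
  have hd (t : R) : x <= t <= y -> is_derive t 1 h 0.
    move=> /andP[xt _]; have mt := lt_le_trans mx xt.
    have g1 := Gd m t mt; have g2 := Gd p t (le_lt_trans mp' mt).
    by rewrite /h; apply: is_derive_eq; rewrite subrr.
  have h1 := le0_is_derive_le xy hd (fun _ _ => lexx 0).
  have hd' (t : R) : x <= t <= y -> is_derive t 1 (fun s => - h s) 0.
    by move=> /hd ?; apply: is_derive_eq; rewrite oppr0.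
  have h2 := le0_is_derive_le xy hd' (fun _ _ => lexx 0).
  move: h1 h2; rewrite /h; lra.
pose H (m : nat) (t : R) := G m t - G m 0.
have HE (m p : nat) (t : R) : (0 < m)%N -> (0 < p)%N -> - m%:R < t -> - p%:R < t ->
    H m t = H p t.
  wlog mp : m p / (m <= p)%N.
    move=> W m0 p0 mt pt; have [?|/ltnW ?] := leqP m p; first exact: W.
    by apply/esym/W.
  move=> m0 p0 mt pt; rewrite /H.
  have mneg : - m%:R < 0 :> R by rewrite oppr_lt0 ltr0n.
  have [t0|/ltW t0] := leP 0 t; first exact: Gconst.
  have := Gconst m p t 0 mp mt t0; lra.
pose idx (t : R) := (Num.truncn `|t|).+2.
exists (fun t => H (idx t) t); split; first by rewrite /H subrr.
move=> t.
have idxlt s : - (idx s)%:R < s.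
  have := truncnS_gt `|s|; rewrite /idx => h.
  have h2 : `|s| < (Num.truncn `|s|).+2%:R.
    by apply: (lt_trans h); rewrite ltr_nat.
  have := ler_norm (- s); rewrite normrN; lra.
have tlt : - (idx t)%:R + 1 < t.
  have := truncnS_gt `|t|; rewrite /idx => h.
  rewrite -[_.+2%:R]natr1; have := ler_norm (- t); rewrite normrN; lra.
have Ht : is_derive t 1 (H (idx t)) (f t).
  have g := Gd (idx t) t (idxlt t).
  by rewrite /H; apply: is_derive_eq; rewrite subr0.
apply: near_eq_is_derive Ht.
near=> s.
apply: HE => //.
have : ball t 1 s by near: s; exact: nbhsx_ballx.
rewrite /ball /= ltr_norml => /andP[h1 h2]; move: tlt h1 h2; lra.
Unshelve. all: by end_near. Qed.

End OneVariable.

(** * Ordinary differential equations with a Lipschitz right-hand side *)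

Section Curves.
Context {R : realType} {n : nat}.
Implicit Types (u v : 'rV[R]_n) (z : R -> 'rV[R]_n).

Lemma coord_le_norm u i : `|u 0 i| <= `|u|.
Proof.
rewrite [leRHS]/Num.Def.normr/= mx_normrE.
exact: (le_bigmax _ (fun ij : 'I_1 * 'I_n => `|u ij.1 ij.2|) (0, i)).
Qed.

Lemma norm_le_coord u (c : R) : 0 <= c -> (forall i, `|u 0 i| <= c) -> `|u| <= c.
Proof.
move=> c0 uc; rewrite [leLHS]/Num.Def.normr/= mx_normrE.
by apply: (bigmax_le _ c0) => -[i j] _ /=; rewrite ord1.
Qed.

Lemma is_derive_coord z (t : R) v i :
  is_derive t 1 z v -> is_derive t 1 (fun s => z s 0 i) (v 0 i).
Proof.
move=> [zd <-]; split; first by have /derivable_mxP := zd; apply.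
by rewrite derive_mx // mxE.
Qed.

Lemma is_derive_row z (t : R) v :
  (forall i, is_derive t 1 (fun s => z s 0 i) (v 0 i)) -> is_derive t 1 z v.
Proof.
move=> zi.
have zd : derivable z t 1 by apply/derivable_mxP => i j; rewrite ord1; case: (zi j).
split=> //; rewrite derive_mx //; apply/rowP => i; rewrite mxE.
by case: (zi i).
Qed.

Lemma is_derive_continuous z (dz : R -> 'rV[R]_n) :
  (forall t : R, is_derive t 1 z (dz t)) -> continuous z.
Proof.
move=> zd t; apply: differentiable_continuous.
by apply/derivable1_diffP; case: (zd t).
Qed.

End Curves.

Lemma near_dist_le {R : realType} {V : normedModType R} (x : V) (e : R) :
  0 < e -> \forall y \near x, `|x - y| <= e.
Proof. by move=> e0; apply: cvgr_dist_le e0; exact: cvg_id. Qed.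

Lemma lipschitz_continuous {R : realType} {V W : normedModType R}
    (f : V -> W) (L : R) : 0 < L ->
  (forall u v, `|f u - f v| <= L * `|u - v|) -> continuous f.
Proof.
move=> L0 lipf u; apply/cvgrPdist_le => e e0; near=> v.
apply: (le_trans (lipf _ _)).
rewrite -ler_pdivlMl //; near: v.
by apply: near_dist_le; rewrite mulr_gt0 // invr_gt0.
Unshelve. all: by end_near. Qed.

Lemma inv_pow2_small {R : realType} (C e : R) :
  0 <= C -> 0 < e -> exists k : nat, C / 2 ^+ k <= e.
Proof.
move=> C0 e0; exists (Num.truncn (C / e)).+1.
rewrite ler_pdivrMr ?exprn_gt0 // -ler_pdivrMl // mulrC.
apply/ltW/(lt_le_trans (truncnS_gt _)).
by rewrite -natrX ler_nat; apply/ltnW/ltn_expl.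
Qed.

Lemma locally_uniform_limit_continuous {R : realType} {U V : normedModType R}
    (z : U -> V) (u : nat -> U -> V) (C : R -> R) :
  (forall k, continuous (u k)) -> {homo C : s t / s <= t} -> 0 <= C 0 ->
  (forall k t, `|z t - u k t| <= C `|t| / 2 ^+ k) -> continuous z.
Proof.
move=> uc Cmono C0 zu t; apply/cvgrPdist_le => e e0.
have [||k hk] := @inv_pow2_small R (C (`|t| + 1)) (e / 3).
- by apply: (le_trans C0); apply: Cmono; rewrite addr_ge0.
- by rewrite divr_gt0.
have close s : `|s| <= `|t| + 1 -> `|z s - u k s| <= e / 3.
  move=> hs; apply: (le_trans (zu k s)); apply: le_trans hk.
  by rewrite ler_pM2r ?invr_gt0 ?exprn_gt0 // Cmono.
have e3 : 0 < e / 3 by rewrite divr_gt0.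
have /cvgrPdist_le/(_ _ e3) uck := uc k t.
near=> s.
have h1 : `|z t - u k t| <= e / 3 by apply: close; rewrite lerDl.
have h2 : `|z s - u k s| <= e / 3.
  apply: close; have : `|t - s| <= 1 by near: s; exact: near_dist_le.
  by have := ler_normB t (t - s); rewrite subKr; lra.
have h3 : `|u k t - u k s| <= e / 3.
  by near: s; exact: uck.
have -> : z t - z s = (z t - u k t) + (u k t - u k s) - (z s - u k s).
  by rewrite opprB !subrKA.
apply: (le_trans (ler_normB _ _)).
apply: (le_trans (lerD (ler_normD _ _) (lexx _))).
by lra.
Unshelve. all: by end_near. Qed.

Section Picard.
Context {R : realType} {n : nat}.
Variables (Y : 'rV[R]_n -> 'rV[R]_n) (L : R) (z0 : 'rV[R]_n).
Hypothesis L0 : 0 < L.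
Hypothesis lipY : forall u v, `|Y u - Y v| <= L * `|u - v|.

Let contY : continuous Y.
Proof. exact: lipschitz_continuous L0 lipY. Qed.

Lemma vector_primitive (g : R -> 'rV[R]_n) : exists G : R -> 'rV[R]_n,
  continuous g -> G 0 = 0 /\ forall t : R, is_derive t 1 G (g t).
Proof.
have [cg|ncg] := pselect (continuous g); last by exists g.
have cgi i : continuous (fun t => g t 0 i).
  move=> t; apply: (@continuous_comp _ _ _ g (fun u : 'rV[R]_n => u 0 i)).
    exact: cg.
  exact: coord_continuous.
have /choice[G HG] i := primitive_exists (cgi i).
exists (fun t => \row_i G i t) => _; split.
  by apply/rowP => i; rewrite !mxE (HG i).1.
move=> t; apply: is_derive_row => i.
by under eq_fun do rewrite mxE; exact: (HG i).2.
Qed.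

Let prim : (R -> 'rV[R]_n) -> R -> 'rV[R]_n := projT1 (choice vector_primitive).
Let primP g : continuous g -> prim g 0 = 0 /\ forall t : R, is_derive t 1 (prim g) (g t).
Proof. exact: (projT2 (choice vector_primitive)). Qed.

Let step (u : R -> 'rV[R]_n) : R -> 'rV[R]_n := fun t => z0 + prim (Y \o u) t.

Let continuous_comp_Y (u : R -> 'rV[R]_n) : continuous u -> continuous (Y \o u).
Proof. by move=> cu t; apply: continuous_comp; [exact: cu|exact: contY]. Qed.

Let stepP u : continuous u ->
  step u 0 = z0 /\ forall t : R, is_derive t 1 (step u) (Y (u t)).
Proof.
move=> cu; have [p0 pd] := primP (continuous_comp_Y cu).
split; first by rewrite /step p0 addr0.
by move=> t; have h := pd t; rewrite /step; apply: is_derive_eq; rewrite add0r.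
Qed.

Let iterate (k : nat) : R -> 'rV[R]_n := iter k step (fun=> z0).

Let iterate_cont k : continuous (iterate k).
Proof.
elim: k => [|k IH]; first by move=> t; exact: cvg_cst.
exact: is_derive_continuous (stepP IH).2.
Qed.

(** One Picard step contracts by a factor 2 in the weighted norm
    [sup_t |u t| exp (- 2 L |t|)]. *)
Let step_contraction (B : R) u v : continuous u -> continuous v ->
  (forall t, `|u t - v t| <= B * expR (2 * L * `|t|)) ->
  forall t, `|step u t - step v t| <= B / 2 * expR (2 * L * `|t|).
Proof.
move=> cu cv uv t.
have [u0 ud] := stepP cu; have [v0 vd] := stepP cv.
have B0 : 0 <= B.
  have := uv 0; rewrite normr0 mulr0 expR0 mulr1; exact: le_trans.
apply: norm_le_coord => [|i].
  by rewrite mulr_ge0 ?divr_ge0 // ltW // expR_gt0.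
have dif (s : R) : is_derive s 1 (fun s => (step u s - step v s) 0 i)
                          ((Y (u s) - Y (v s)) 0 i).
  by apply: (@is_derive_coord R n (fun s => step u s - step v s)); exact: is_deriveB.
have L2 : 0 < 2 * L by rewrite mulr_gt0.
have -> : B / 2 = L * B / (2 * L) by field; rewrite gt_eqF.
apply: (exp_envelope L2 _ dif); first by rewrite u0 v0 subrr mxE.
move=> s; apply: (le_trans (coord_le_norm _ _)); apply: (le_trans (lipY _ _)).
by rewrite -mulrA ler_pM2l.
Qed.

(** The exponential weight makes the Picard iteration converge for all times at
    once, so that no continuation of local solutions is needed. *)
Theorem picard_global : exists z : R -> 'rV[R]_n,
  z 0 = z0 /\ forall t : R, is_derive t 1 z (Y (z t)).
Proof.
pose E (t : R) := expR (2 * L * `|t|).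
have E0 (t : R) : 0 < E t by exact: expR_gt0.
pose B := `|Y z0| / L.
have B0 : 0 <= B by rewrite divr_ge0 // ltW.
have BE (t : R) : 0 <= B * E t by rewrite mulr_ge0 // ltW.
have base (t : R) : `|iterate 1%N t - iterate 0%N t| <= B * E t.
  have [u0 ud] := stepP (@iterate_cont 0%N).
  have L2 : 0 < 2 * L by rewrite mulr_gt0.
  apply: norm_le_coord => [|i]; first by rewrite mulr_ge0 // ltW.
  have dif (s : R) : is_derive s 1 (fun s => (step (iterate 0%N) s - z0) 0 i) (Y z0 0 i).
    apply: (@is_derive_coord R n (fun s => step (iterate 0%N) s - z0)).
    by have h := ud s; apply: is_derive_eq; rewrite subr0.
  have H : forall s : R, `|Y z0 0 i| <= 2 * `|Y z0| * expR (2 * L * `|s|).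
    move=> s; apply: (le_trans (coord_le_norm _ _)).
    have e1 : 1 <= expR (2 * L * `|s|).
      by rewrite -[leLHS]expR0 ler_expR !mulr_ge0 // ltW.
    rewrite mulrAC -[leLHS]mul1r ler_wpM2r //.
    by apply: (le_trans e1); rewrite ler_peMl ?ler1n // ltW // expR_gt0.
  have -> : B = 2 * `|Y z0| / (2 * L) by rewrite /B; field; rewrite gt_eqF.
  by apply: (exp_envelope L2 _ dif H); rewrite u0 subrr mxE.
have steps k (t : R) : `|iterate k.+1 t - iterate k t| <= B * E t / 2 ^+ k.
  elim: k t => [|k IH] t; first by rewrite expr0 divr1.
  have IH' (s : R) : `|iterate k.+1 s - iterate k s| <= B / 2 ^+ k * E s.
    by rewrite mulrAC.
  have := step_contraction (@iterate_cont k.+1) (@iterate_cont k) IH' t.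
  have -> // : B * E t / 2 ^+ k.+1 = B / 2 ^+ k / 2 * expR (2 * L * `|t|).
  by rewrite exprS /E; field; rewrite expf_neq0.
have /choice[w Hw] (ti : R * 'I_n) : exists l, forall k,
    `|l - iterate k ti.1 0 ti.2| <= 2 * (B * E ti.1) / 2 ^+ k.
  apply: geometric_steps_limit; first by rewrite mulr_ge0 // ltW.
  move=> k; apply: le_trans (steps k ti.1).
  by have := coord_le_norm (iterate k.+1 ti.1 - iterate k ti.1) ti.2; rewrite !mxE.
pose z (t : R) : 'rV[R]_n := \row_i w (t, i).
have zlim k (t : R) : `|z t - iterate k t| <= 2 * (B * E t) / 2 ^+ k.
  apply: norm_le_coord => [|i]; last by rewrite !mxE; exact: (Hw (t, i)).
  by apply: divr_ge0; [apply: mulr_ge0|apply: exprn_ge0].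
have zcont : continuous z.
  apply: (locally_uniform_limit_continuous (U := R^o) (C := fun s => 2 * (B * expR (2 * L * s)))
            iterate_cont) zlim.
  - move=> s t st; rewrite ler_pM2l // ler_wpM2l // ler_expR ler_pM2l //.
    by rewrite mulr_gt0.
  - by apply: mulr_ge0 => //; apply: mulr_ge0 => //; apply/ltW/expR_gt0.
have [s0 sd] := stepP zcont.
suff zstep : z = step z.
  by exists z; rewrite {1}zstep; split=> // t; rewrite {1}zstep.
apply/funext => t; apply/eqP; rewrite -subr_eq0 -normr_le0.
apply/ler_addgt0Pr => e e0; rewrite add0r.
have [|k hk] := @inv_pow2_small R (2 * (B * E t)) e _ e0.
  by apply: mulr_ge0.
have h1 := zlim k.+1 t.
have zk (s : R) : `|z s - iterate k s| <= 2 * B / 2 ^+ k * expR (2 * L * `|s|).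
  by have := zlim k s; rewrite mulrA mulrAC.
have h2 := step_contraction zcont (@iterate_cont k) zk t.
rewrite -[z t](subrK (iterate k.+1 t)) -addrA.
apply: (le_trans (ler_normD _ _)); apply: le_trans hk.
rewrite [X in _ + X]distrC; apply: (le_trans (lerD h1 h2)).
have p0 : 2 ^+ k != 0 :> R by rewrite expf_neq0.
rewrite exprS /E le_eqVlt; apply/orP; left; apply/eqP; field.
by [].
Qed.

End Picard.

(** * Differential calculus on normed spaces *)

Section NormedCalculus.
Context {R : realType} {V : normedModType R}.
Implicit Types (F : V -> R) (z v : V).

Lemma quadratically_small_differentiable F z (C r : R) : 0 < r ->
  (forall w, `|w - z| < r -> `|F w| <= C * `|w - z| ^+ 2) -> differentiable F z.
Proof.
move=> r0 FC.
have Fz : F z = 0.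
  apply/eqP; rewrite -normr_eq0 eq_le normr_ge0 andbT.
  by have := FC z; rewrite subrr normr0 expr0n mulr0; apply.
have expansion : F \o shift z = cst (F z) + \0 +o_ 0 id.
  apply/eqaddoP => e e0; near=> h.
  rewrite [X in `|X| <= _](_ : _ = F (h + z)); last first.
    by rewrite !fctE /= Fz addr0 subr0.
  have hr : `|h| < r by near: h; apply: nbhs0_lt.
  have := FC (h + z); rewrite addrK => /(_ hr) /le_trans; apply.
  rewrite expr2 mulrA ler_wpM2r //.
  have he : `|h| <= e / (`|C| + 1).
    by near: h; apply: nbhs0_le; rewrite divr_gt0 // ltr_wpDl.
  apply: (@le_trans _ _ ((`|C| + 1) * `|h|)).
    by rewrite ler_wpM2r // ler_wpDr // ler_norm.
  by rewrite mulrC -ler_pdivlMr // ltr_wpDl.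
apply/diff_locallyP; rewrite (diff_unique _ expansion); last exact: cst_continuous.
by split; [exact: cst_continuous|exact: expansion].
Unshelve. all: by end_near. Qed.

Lemma derive_le_lipschitz F z v (K r : R) : 0 < r -> derivable F z v ->
  (forall h : R, `|h| < r -> `|F (h *: v + z) - F z| <= K * `|h|) ->
  `|'D_v F z| <= K.
Proof.
move=> r0 dF FK; apply/ler_addgt0Pr => e e0.
have H : h^-1 *: (F (h *: v + z) - F z) @[h --> 0^'] --> ('D_v F z : R) by [].
move/cvgrPdist_le : H => /(_ _ e0) H.
near (0 : R)^' => h.
have h0 : h != 0 by near: h; exact: nbhs_dnbhs_neq.
have hr : `|h| < r by near: h; exact: dnbhs0_lt.
have he : `|'D_v F z - h^-1 *: (F (h *: v + z) - F z)| <= e by near: h.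
rewrite -['D_v F z](subrK (h^-1 *: (F (h *: v + z) - F z))).
apply: (le_trans (ler_normD _ _)); rewrite addrC lerD //.
rewrite /GRing.scale /= normrM normfV mulrC ler_pdivrMr ?normr_gt0 //.
exact: FK.
Unshelve. all: by end_near. Qed.

Lemma is_derive_along F (z : R -> V) (t : R) v : differentiable F (z t) ->
  is_derive t 1 z v -> is_derive t 1 (F \o z) ('d F (z t) v).
Proof.
move=> dF [dz <-]; have dz' : differentiable z t by exact/derivable1_diffP.
have dFz : differentiable (F \o z) t by exact: differentiable_comp.
split; first exact/derivable1_diffP.
by rewrite deriveE // diff_comp //= [in RHS]deriveE.
Qed.

End NormedCalculus.

(** * The phase space *)

Section PhaseSpace.
Context {R : realType} {N : nat}.
Notation n := (sites N + sites N)%N.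
Implicit Types (u v w z : phase R N) (F G : phase R N -> R).

Definition dot u v : R := \sum_i u 0 i * v 0 i.

Lemma dotC u v : dot u v = dot v u.
Proof. by apply: eq_bigr => i _; rewrite mulrC. Qed.

Lemma dotDl u v w : dot (u + v) w = dot u w + dot v w.
Proof. by rewrite -big_split; apply: eq_bigr => i _; rewrite mxE mulrDl. Qed.

Lemma dotNl u w : dot (- u) w = - dot u w.
Proof. by rewrite -sumrN; apply: eq_bigr => i _; rewrite mxE mulNr. Qed.

Lemma dotZl (a : R) u w : dot (a *: u) w = a * dot u w.
Proof. by rewrite mulr_sumr; apply: eq_bigr => i _; rewrite mxE mulrA. Qed.

Lemma dotBl u v w : dot (u - v) w = dot u w - dot v w.
Proof. by rewrite dotDl dotNl. Qed.

Lemma dotDr u v w : dot w (u + v) = dot w u + dot w v.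
Proof. by rewrite dotC dotDl !(dotC w). Qed.

Lemma dotBr u v w : dot w (u - v) = dot w u - dot w v.
Proof. by rewrite dotC dotBl !(dotC w). Qed.

Lemma dotZr (a : R) u w : dot w (a *: u) = a * dot w u.
Proof. by rewrite dotC dotZl dotC. Qed.

Lemma dot_ge0 u : 0 <= dot u u.
Proof. by apply: sumr_ge0 => i _; rewrite -expr2 sqr_ge0. Qed.

Lemma enorm_dot u : enorm u = Num.sqrt (dot u u).
Proof. by rewrite /enorm /dot; under eq_bigr do rewrite expr2. Qed.

Lemma enorm_ge0 u : 0 <= enorm u.
Proof. exact: sqrtr_ge0. Qed.

Lemma enorm_sqr u : enorm u ^+ 2 = dot u u.
Proof. by rewrite enorm_dot sqr_sqrtr // dot_ge0. Qed.

Lemma coord_le_enorm u i : `|u 0 i| <= enorm u.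
Proof.
rewrite -sqrtr_sqr; apply: ler_wsqrtr.
by rewrite (bigD1 i) //= lerDl sumr_ge0 // => j _; rewrite sqr_ge0.
Qed.

Lemma enorm_le_coord u (c : R) : 0 <= c -> (forall i, `|u 0 i| <= c) ->
  enorm u <= n%:R * c.
Proof.
move=> c0 uc; have n1 : 1 <= n%:R :> R by rewrite ler1n.
rewrite -(@ler_pXn2r _ 2) ?nnegrE ?enorm_ge0 ?mulr_ge0 // enorm_sqr.
apply: (@le_trans _ _ (\sum_(i < n) c ^+ 2)).
  apply: ler_sum => i _; rewrite -expr2 -real_normK ?num_real //.
  by rewrite ler_pXn2r ?nnegrE.
rewrite sumr_const card_ord -[leLHS]mulr_natl exprMn ler_wpM2r ?sqr_ge0 //.
by rewrite expr2 ler_peMl // ler0n.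
Qed.

Lemma dot_le_enorm u v : dot u v <= enorm u * enorm v.
Proof.
set a := enorm u; set b := enorm v.
have a0 : 0 <= a := enorm_ge0 u. have b0 : 0 <= b := enorm_ge0 v.
have zero w : enorm w = 0 -> forall i, w 0 i = 0.
  move=> w0 i; apply/eqP; rewrite -normr_eq0 eq_le normr_ge0 andbT -w0.
  exact: coord_le_enorm.
have := dot_ge0 (b *: u - a *: v).
rewrite !dotBl !dotBr !dotZl !dotZr -!enorm_sqr -/a -/b (dotC v u) => H.
have [ab0|] := leP (a * b) 0; last by move=> ab; nra.
have : (a == 0) || (b == 0) by rewrite -mulf_eq0 eq_le ab0 mulr_ge0.
case/orP => /eqP /zero w0; rewrite /dot big1 ?mulr_ge0 // => i _;
  by rewrite w0 ?mul0r ?mulr0.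
Qed.

Lemma enormD_le u v : enorm (u + v) <= enorm u + enorm v.
Proof.
rewrite -(@ler_pXn2r _ 2) ?nnegrE ?addr_ge0 ?enorm_ge0 //.
rewrite enorm_sqr dotDl !dotDr (dotC v u) sqrrD !enorm_sqr.
have := dot_le_enorm u v; lra.
Qed.

Lemma enormZ (a : R) u : enorm (a *: u) = `|a| * enorm u.
Proof.
by rewrite !enorm_dot dotZl dotZr mulrA -expr2 sqrtrM ?sqr_ge0 // sqrtr_sqr.
Qed.

Lemma enormN u : enorm (- u) = enorm u.
Proof. by rewrite -scaleN1r enormZ normrN1 mul1r. Qed.

Lemma is_derive_dot (z : R -> phase R N) (t : R) v :
  is_derive t 1 z v -> is_derive t 1 (fun s => dot (z s) (z s)) (2 * dot (z t) v).
Proof.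
move=> zd.
pose h (i : 'I_n) (s : R) : R := z s 0 i * z s 0 i.
have hd i : is_derive t 1 (h i) (2 * (z t 0 i * v 0 i)).
  have zi := is_derive_coord i zd.
  apply: (is_derive_eq (is_deriveM zi zi)).
  by rewrite /GRing.scale /=; ring.
have := @is_derive_sum R R R n h t 1 _ hd.
rewrite /dot mulr_sumr; congr (is_derive _ _ _ _).
by apply/funext => s; rewrite fct_sumE.
Qed.

(** ** Hamiltonian vector fields *)

Definition gradient F z : phase R N := \row_i partial i F z.

Lemma differential_gradient F z v : differentiable F z ->
  'd F z v = dot v (gradient F z).
Proof.
move=> dF; rewrite {1}(row_sum_delta v) linear_sum.
apply: eq_bigr => i _; rewrite mxE linearZ /=.
by rewrite /partial deriveE.
Qed.

(** The multiplication by [- i] in the complex coordinates [psi_j]. *)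
Definition rotate z : phase R N :=
  row_mx (\row_j z 0 (pidx N j)) (- \row_j z 0 (qidx N j)).

Lemma rotateE_q z j : rotate z 0 (qidx N j) = z 0 (pidx N j).
Proof. by rewrite row_mxEl mxE. Qed.

Lemma rotateE_p z j : rotate z 0 (pidx N j) = - z 0 (qidx N j).
Proof. by rewrite row_mxEr !mxE. Qed.

Lemma hamvf_rotate F z : hamvf F z = rotate (gradient F z).
Proof. by congr row_mx; [|congr (- _)]; apply/rowP => j; rewrite !mxE. Qed.

Lemma dot_split u v :
  dot u v = \sum_j (u 0 (qidx N j) * v 0 (qidx N j) + u 0 (pidx N j) * v 0 (pidx N j)).
Proof. by rewrite /dot big_split_ord big_split. Qed.

Lemma dot_rotater u v : dot u (rotate v) = - dot (rotate u) v.
Proof.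
rewrite !dot_split -sumrN; apply: eq_bigr => j _.
by rewrite !rotateE_q !rotateE_p; ring.
Qed.

Lemma enorm_rotate z : enorm (rotate z) = enorm z.
Proof.
rewrite !enorm_dot; congr Num.sqrt; rewrite !dot_split; apply: eq_bigr => j _.
by rewrite !rotateE_q !rotateE_p; ring.
Qed.

Lemma phase_ext u v : (forall j, u 0 (qidx N j) = v 0 (qidx N j)) ->
  (forall j, u 0 (pidx N j) = v 0 (pidx N j)) -> u = v.
Proof.
move=> uq up; apply/rowP => i; rewrite -[i]splitK.
by case: (fintype.split i) => j; [exact: uq|exact: up].
Qed.

Lemma rotateB u v : rotate (u - v) = rotate u - rotate v.
Proof.
have subE (a b : phase R N) i : (a - b) 0 i = a 0 i - b 0 i by rewrite !mxE.
apply: phase_ext => j; rewrite subE ?rotateE_q ?rotateE_p subE //.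
by rewrite opprB opprK addrC.
Qed.

(** The Hamiltonian vector field is the gradient rotated by a right angle. *)
Lemma differential_hamvf F z : differentiable F z -> 'd F z (hamvf F z) = 0.
Proof.
move=> dF; rewrite differential_gradient // hamvf_rotate.
have := dot_rotater (gradient F z) (gradient F z).
by rewrite dotC (dotC (rotate _)) => H; lra.
Qed.

Lemma energy_conserved F (z : R -> phase R N) (s T : R) : 0 <= T ->
  (forall t, 0 <= t <= T -> differentiable F (z t)) ->
  (forall t, 0 <= t <= T -> is_derive t 1 z (s *: hamvf F (z t))) ->
  F (z T) = F (z 0).
Proof.
move=> T0 dF zd.
have Fd (t : R) : 0 <= t <= T -> is_derive t 1 (F \o z) 0.
  move=> tT; have h := is_derive_along (dF t tT) (zd t tT).
  by apply: (is_derive_eq h); rewrite linearZ /= (differential_hamvf (dF t tT)) /GRing.scale /= mulr0.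
have [||c] := @MVT_segment _ (F \o z) (fun=> 0) 0 T T0.
- by move=> x; rewrite in_itv /= => /andP[/ltW ? /ltW ?]; apply: Fd; apply/andP.
- exact: is_derive_continuous_within Fd.
by move=> _ /=; rewrite mul0r => /subr0_eq.
Qed.

End PhaseSpace.

(** * Polynomials as functions on the phase space *)

(** The differential of a polynomial function, locked to keep unification away
    from the definition of the differential. *)
HB.lock Definition dpeval (R : realType) (N : nat) (p : poly R N)
  (z v : phase R N) : R := 'd (peval p) z v.

Section PolynomialCalculus.
Context {R : realType} {N : nat}.
Notation n := (sites N + sites N)%N.
Implicit Types (p q : poly R N) (z v w : phase R N) (F : phase R N -> R).

Lemma poly_ring_ind (P : poly R N -> Prop) : P 1 ->
  (forall i, P (var R N i)) -> (forall p q, P p -> P q -> P (p + q)) ->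
  (forall p q, P p -> P q -> P (p * q)) ->
  (forall c p, P p -> P (c *: p)) -> forall p, P p.
Proof.
move=> P1 PX PD PM PZ p.
have P0 : P 0 by rewrite -(scale0r (1 : poly R N)); exact: PZ.
rewrite (mpoly.mpolyE p); apply: big_ind => // m _; apply: PZ.
rewrite mpoly.mpolyXE_id; apply: big_ind => // i _.
by elim: (mpoly.fun_of_multinom m i) => [|k IH]; [rewrite expr0|rewrite exprS; apply: PM].
Qed.

Lemma pevalD p q : peval (p + q) = peval p + peval q.
Proof. by apply/funext => z; rewrite /peval mpoly.mevalD. Qed.

Lemma pevalM p q : peval (p * q) = peval p * peval q.
Proof. by apply/funext => z; rewrite /peval mpoly.mevalM. Qed.

Lemma pevalZ (c : R) p : peval (c *: p) = c *: peval p.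
Proof. by apply/funext => z; rewrite /peval mpoly.mevalZ. Qed.

Lemma peval1 : peval (1 : poly R N) = cst 1.
Proof. by apply/funext => z; rewrite /peval mpoly.meval1. Qed.

Lemma peval0 : peval (0 : poly R N) = cst 0.
Proof. by apply/funext => z; rewrite /peval mpoly.meval0. Qed.

Lemma peval_var i : peval (var R N i) = fun z : phase R N => z 0 i.
Proof. by apply/funext => z; rewrite /peval mpoly.mevalXU. Qed.

Lemma peval_differentiable p z : differentiable (peval p) z.
Proof.
elim/poly_ring_ind: p => [|i|p q hp hq|p q hp hq|c p hp].
- by rewrite peval1; exact: differentiable_cst.
- by rewrite peval_var; exact: differentiable_coord.
- by rewrite pevalD; exact: differentiableD.
- by rewrite pevalM; exact: differentiableM.
- by rewrite pevalZ; exact: differentiableZ.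
Qed.
Hint Resolve peval_differentiable : core.

Lemma dpeval_var i z v : dpeval (var R N i) z v = v 0 i.
Proof.
rewrite dpeval.unlock -deriveE // peval_var.
have := @derive_mx R (phase R N) 1 n id z v (@derivable_id _ _ z v).
by rewrite derive_id => /matrixP/(_ 0 i); rewrite mxE.
Qed.

Lemma dpeval0 z v : dpeval (0 : poly R N) z v = 0.
Proof. by rewrite dpeval.unlock peval0 diff_cst. Qed.

Lemma dpevalD p q z v : dpeval (p + q) z v = dpeval p z v + dpeval q z v.
Proof.
rewrite dpeval.unlock pevalD.
by rewrite (diffD (peval_differentiable p z) (peval_differentiable q z)).
Qed.

Lemma dpevalZ (c : R) p z v : dpeval (c *: p) z v = c * dpeval p z v.
Proof. by rewrite dpeval.unlock pevalZ (diffZ c (peval_differentiable p z)). Qed.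

Lemma dpevalM p q z v :
  dpeval (p * q) z v = peval p z * dpeval q z v + peval q z * dpeval p z v.
Proof.
rewrite dpeval.unlock pevalM.
by rewrite (diffM (peval_differentiable p z) (peval_differentiable q z)).
Qed.

Lemma gradient_peval p z :
  gradient (peval p) z = \row_i dpeval p z (delta_mx 0 i).
Proof. by apply/rowP => i; rewrite dpeval.unlock !mxE /partial deriveE. Qed.

(** ** Gauge invariance *)

(** Invariance under the flow of [sum_j (q_j^2 + p_j^2) / 2], whose vector field
    is [rotate]. *)
Definition gauge_invariant p := forall z, dpeval p z (rotate z) = 0.

Lemma gauge_invariant_dot p z : gauge_invariant p -> dot z (hamvf (peval p) z) = 0.
Proof.
move=> gp; have := gp z.
rewrite dpeval.unlock (differential_gradient _ (peval_differentiable p z)).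
by rewrite hamvf_rotate dot_rotater => ->; rewrite oppr0.
Qed.

Lemma gauge_invariantD p q :
  gauge_invariant p -> gauge_invariant q -> gauge_invariant (p + q).
Proof. by move=> gp gq z; rewrite dpevalD gp gq addr0. Qed.

Lemma gauge_invariantZ (c : R) p : gauge_invariant p -> gauge_invariant (c *: p).
Proof. by move=> gp z; rewrite dpevalZ gp mulr0. Qed.

Lemma gauge_invariantM p q :
  gauge_invariant p -> gauge_invariant q -> gauge_invariant (p * q).
Proof. by move=> gp gq z; rewrite dpevalM gp gq !mulr0 addr0. Qed.

Lemma gauge_invariant_sum (I : Type) (s : seq I) (P : pred I) (f : I -> poly R N) :
  (forall i, P i -> gauge_invariant (f i)) ->
  gauge_invariant (\sum_(i <- s | P i) f i).
Proof.
move=> gf; apply: (big_ind gauge_invariant) gf.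
  by move=> z; exact: dpeval0.
exact: gauge_invariantD.
Qed.

(** This is [2 Re (psi_i conj psi_j)]. *)
Definition coupling (i j : 'I_(sites N)) : poly R N :=
  qvar R N i * qvar R N j + pvar R N i * pvar R N j.

Lemma dpeval_coupling i j z v : dpeval (coupling i j) z v =
  z 0 (qidx N i) * v 0 (qidx N j) + z 0 (qidx N j) * v 0 (qidx N i)
  + (z 0 (pidx N i) * v 0 (pidx N j) + z 0 (pidx N j) * v 0 (pidx N i)).
Proof.
have prod k l : dpeval (var R N k * var R N l) z v
    = z 0 k * v 0 l + z 0 l * v 0 k.
  apply: etrans (dpevalM _ _ _ _) _.
  by congr (_ * _ + _ * _); [exact: (congr1 (@^~ z) (peval_var k))|exact: dpeval_var
    |exact: (congr1 (@^~ z) (peval_var l))|exact: dpeval_var].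
apply: etrans (dpevalD _ _ _ _) _.
by congr (_ + _); exact: prod.
Qed.

Lemma gauge_invariant_coupling i j : gauge_invariant (coupling i j).
Proof. by move=> z; rewrite dpeval_coupling !rotateE_q !rotateE_p; ring. Qed.

(** ** Quadratic Hamiltonians *)

(** [p] is a quadratic form up to an additive constant. *)
Definition linear_gradient p := forall z w v,
  dpeval p (z - w) v = dpeval p z v - dpeval p w v.

Lemma linear_gradientD p q :
  linear_gradient p -> linear_gradient q -> linear_gradient (p + q).
Proof. by move=> lp lq z w v; rewrite !dpevalD lp lq; ring. Qed.

Lemma linear_gradientZ (c : R) p : linear_gradient p -> linear_gradient (c *: p).
Proof. by move=> lp z w v; rewrite !dpevalZ lp; ring. Qed.

Lemma linear_gradient_sum (I : Type) (s : seq I) (P : pred I) (f : I -> poly R N) :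
  (forall i, P i -> linear_gradient (f i)) ->
  linear_gradient (\sum_(i <- s | P i) f i).
Proof.
move=> gf; apply: (big_ind linear_gradient) gf; last exact: linear_gradientD.
by move=> z w v; rewrite !dpeval0 subr0.
Qed.

Lemma linear_gradient_coupling i j : linear_gradient (coupling i j).
Proof.
have subE (a b : phase R N) k : (a - b) 0 k = a 0 k - b 0 k by rewrite !mxE.
by move=> z w v; rewrite !dpeval_coupling !subE; ring.
Qed.

Lemma hamvfB p z w : linear_gradient p ->
  hamvf (peval p) (z - w) = hamvf (peval p) z - hamvf (peval p) w.
Proof.
move=> lp; rewrite !hamvf_rotate -rotateB; congr rotate.
by rewrite !gradient_peval; apply/rowP => i; rewrite !mxE lp.
Qed.

(** ** Cyclic shifts *)

Lemma shift_idx_q j : shift_idx (qidx N j) = qidx N (ordS j).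
Proof. by rewrite /shift_idx (unsplitK (inl j)). Qed.

Lemma shift_idx_p j : shift_idx (pidx N j) = pidx N (ordS j).
Proof. by rewrite /shift_idx (unsplitK (inr j)). Qed.

Lemma tau_var i : tau (var R N i) = var R N (shift_idx i).
Proof. by rewrite /tau mpoly.comp_mpolyXU -tnth_nth tnth_mktuple. Qed.

Lemma tauD p q : tau (p + q) = tau p + tau q.
Proof. exact: mpoly.comp_mpolyD. Qed.

Lemma tau0 : tau (0 : poly R N) = 0.
Proof. exact: mpoly.comp_mpoly0. Qed.

Lemma tauZ (c : R) p : tau (c *: p) = c *: tau p.
Proof. exact: mpoly.comp_mpolyZ. Qed.

Lemma tauM p q : tau (p * q) = tau p * tau q.
Proof. by rewrite /tau rmorphM. Qed.

Lemma iter_tau_coupling l (b : R) i j :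
  iter l (@tau R N) (b *: coupling i j) =
  b *: coupling (iter l (@ordS _) i) (iter l (@ordS _) j).
Proof.
elim: l => [|l IH] //=; rewrite IH tauZ /coupling tauD !tauM !tau_var.
by rewrite !shift_idx_q !shift_idx_p.
Qed.

Lemma cyc_sum (I : Type) (s : seq I) (P : pred I) (f : I -> poly R N) :
  cyc (\sum_(i <- s | P i) f i) = \sum_(i <- s | P i) cyc (f i).
Proof.
rewrite /cyc exchange_big /=; apply: eq_bigr => l _.
elim: (nat_of_ord l) => [|k IH] //=; rewrite IH.
by apply: big_morph; [exact: tauD|exact: tau0].
Qed.

Lemma peval_tau p z : peval (tau p) z = peval p (\row_i z 0 (shift_idx i)).
Proof.
rewrite /peval /tau mpoly.comp_mpoly_meval; apply: mpoly.meval_eq => i.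
by rewrite tnth_mktuple mpoly.mevalXU mxE.
Qed.

(** ** Lipschitz bounds on cubes *)

(** The behaviour of a homogeneous polynomial of degree [d + 1] on the cubes
    centred at the origin. The sup norm is used because it is invariant under the
    cyclic shifts, so that a bound on a seed passes to the sum of its shifts. *)
Definition lips (d : nat) (K : R) F := F 0 = 0 /\ forall (r D : R) z w,
  (forall i, `|z 0 i| <= r) -> (forall i, `|w 0 i| <= r) ->
  (forall i, `|z 0 i - w 0 i| <= D) -> `|F z - F w| <= K * r ^+ d * D.

Lemma radius_ge0 (r : R) z : (forall i, `|z 0 i| <= r) -> 0 <= r.
Proof. by move=> /(_ 0); apply: le_trans. Qed.

Lemma lips_le d (K K' : R) F : K <= K' -> lips d K F -> lips d K' F.
Proof.
move=> KK [F0 lF]; split=> // r D z w zr wr zw.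
apply: (le_trans (lF r D z w zr wr zw)).
rewrite -!mulrA ler_wpM2r // mulr_ge0 ?exprn_ge0 ?(radius_ge0 zr) //.
by apply: (@radius_ge0 _ (z - w)) => i; rewrite !mxE.
Qed.

Lemma lipsD d (K K' : R) F G : lips d K F -> lips d K' G -> lips d (K + K') (F + G).
Proof.
move=> [F0 lF] [G0 lG]; split=> [|r D z w zr wr zw].
  by rewrite fctE F0 G0 addr0.
have -> : (F + G) z - (F + G) w = (F z - F w) + (G z - G w).
  by rewrite !fctE; ring.
apply: (le_trans (ler_normD _ _)); rewrite !mulrDl lerD //.
  exact: lF. exact: lG.
Qed.

Lemma lips0 d : lips d 0 (peval 0).
Proof. by rewrite peval0; split=> // r D z w _ _ _; rewrite subrr normr0 !mul0r. Qed.

Lemma lips_sum d (I : Type) (s : seq I) (P : pred I) (f : I -> poly R N)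
    (K : I -> R) : (forall i, P i -> lips d (K i) (peval (f i))) ->
  lips d (\sum_(i <- s | P i) K i) (peval (\sum_(i <- s | P i) f i)).
Proof.
move=> lf; apply: (big_ind2 (fun a p => lips d a (peval p))) => //.
  exact: lips0.
by move=> a p b q ? ?; rewrite pevalD; exact: lipsD.
Qed.

Lemma lips_value d (K r : R) F z : lips d K F ->
  (forall i, `|z 0 i| <= r) -> `|F z| <= K * r ^+ d.+1.
Proof.
move=> [F0 lF] zr; have r0 := radius_ge0 zr.
have := lF r r z 0 zr _ _; rewrite F0 subr0 exprSr mulrA; apply => i.
  by rewrite mxE normr0.
by rewrite mxE subr0.
Qed.

(** The three bounds are multiplicative in the monomial. *)
Let lips_prod (r D : R) z w (m : 'I_n -> nat) (s : seq 'I_n) : 0 <= D ->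
  (forall i, `|z 0 i| <= r) -> (forall i, `|w 0 i| <= r) ->
  (forall i, `|z 0 i - w 0 i| <= D) ->
  let d := (\sum_(i <- s) m i)%N in
  [/\ `|\prod_(i <- s) z 0 i ^+ m i| <= r ^+ d,
      `|\prod_(i <- s) w 0 i ^+ m i| <= r ^+ d &
      `|\prod_(i <- s) z 0 i ^+ m i - \prod_(i <- s) w 0 i ^+ m i|
        <= d%:R * r ^+ d.-1 * D].
Proof.
move=> D0 zr wr zw; have r0 := radius_ge0 zr.
pose Q (x y : R) (d : nat) :=
  [/\ `|x| <= r ^+ d, `|y| <= r ^+ d & `|x - y| <= d%:R * r ^+ d.-1 * D].
have QM x y d x' y' d' : Q x y d -> Q x' y' d' -> Q (x * x') (y * y') (d + d')%N.
  move=> [xd yd xy] [xd' yd' xy']; split.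
  - by rewrite normrM exprD ler_pM.
  - by rewrite normrM exprD ler_pM.
  have -> : x * x' - y * y' = x * (x' - y') + (x - y) * y' by ring.
  apply: (le_trans (ler_normD _ _)); rewrite !normrM.
  apply: (@le_trans _ _ (r ^+ d * (d'%:R * r ^+ d'.-1 * D)
                         + (d%:R * r ^+ d.-1 * D) * r ^+ d')).
    by rewrite lerD // ler_pM.
  rewrite natrD !mulrDl addrC; apply: lerD; rewrite le_eqVlt; apply/orP; left; apply/eqP.
    case: d {xd yd xy} => [|d]; first by rewrite !mul0r.
    by rewrite addSn /= exprD; ring.
  case: d' {xd' yd' xy'} => [|d']; first by rewrite !mul0r mulr0.
  by rewrite addnS /= exprD; ring.
have Q1 : Q 1 1 0%N by split; rewrite ?normr1 // subrr normr0 !mul0r.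
have QX i k : Q (z 0 i ^+ k) (w 0 i ^+ k) k.
  elim: k => [|k IH] //; rewrite !exprS; apply: (QM _ _ 1%N _ _ k) => //.
  by split; rewrite ?expr1 //= expr0 !mul1r.
rewrite /=; elim: s => [|i s IH]; first by rewrite !big_nil.
by rewrite !big_cons; exact: QM.
Qed.

Lemma homogeneous_value (d : nat) p (r : R) z : homogeneous d p ->
  (forall i, `|z 0 i| <= r) -> `|peval p z| <= coeff_norm p * r ^+ d.
Proof.
move=> /mpoly.dhomogP hp zr; have r0 := radius_ge0 zr.
rewrite /peval !mpoly.mevalE; apply: (le_trans (ler_norm_sum _ _ _)).
rewrite /coeff_norm mulr_suml big_seq [leRHS]big_seq; apply: ler_sum => m mp.
rewrite normrM ler_wpM2l //.
have [|H _ _] := lips_prod (mpoly.fun_of_multinom m) (index_enum _) r0 zr zr.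
  by move=> i; rewrite subrr normr0.
have hm : mpoly.mdeg m = d := hp m mp.
by rewrite -mpoly.mdegE hm in H.
Qed.

Lemma homogeneous_lips (d : nat) p (c : R) : homogeneous d.+1 p ->
  coeff_norm p <= c -> lips d (d.+1%:R * c) (peval p).
Proof.
move=> hp pc; apply: (lips_le (K := d.+1%:R * coeff_norm p)).
  by rewrite ler_wpM2l.
split=> [|r D z w zr wr zw].
  have := @homogeneous_value _ _ 0 0 hp; rewrite expr0n mulr0 => H.
  by apply/eqP; rewrite -normr_le0; apply: H => i; rewrite mxE normr0.
have /mpoly.dhomogP {}hp := hp.
have D0 : 0 <= D by apply: (@radius_ge0 _ (z - w)) => i; rewrite !mxE.
rewrite /peval !mpoly.mevalE -sumrB.
apply: (le_trans (ler_norm_sum _ _ _)).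
have -> : d.+1%:R * coeff_norm p * r ^+ d * D = coeff_norm p * (d.+1%:R * r ^+ d * D).
  by ring.
rewrite /coeff_norm mulr_suml.
rewrite big_seq [leRHS]big_seq; apply: ler_sum => m mp.
rewrite -mulrBr normrM ler_wpM2l //.
have [_ _] := lips_prod (mpoly.fun_of_multinom m) (index_enum _) D0 zr wr zw.
have hm : mpoly.mdeg m = d.+1 := hp m mp.
rewrite -mpoly.mdegE hm /= ; exact.
Qed.

Lemma lips_tau d (K : R) p : lips d K (peval p) -> lips d K (peval (tau p)).
Proof.
move=> [p0 lp]; split=> [|r D z w zr wr zw].
  by rewrite peval_tau -p0; congr peval; apply/rowP => i; rewrite !mxE.
by rewrite !peval_tau; apply: lp => i; rewrite !mxE.
Qed.

Lemma lips_cyc d (K : R) p : lips d K (peval p) ->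
  lips d ((sites N)%:R * K) (peval (cyc p)).
Proof.
move=> lp; rewrite -[X in X * K]/((sites N)%:R) mulr_natl.
rewrite -[X in K *+ X]card_ord -sumr_const.
apply: lips_sum => l _; elim: (nat_of_ord l) => [|k IH] //=.
exact: lips_tau.
Qed.

End PolynomialCalculus.

(** * Analytic functions and the remainder of the normal form *)

Section Remainder.
Context {R : realType} {N : nat}.
Implicit Types (p : poly R N) (z w : phase R N) (F : phase R N -> R).

Lemma limit_dist_le (a b : nat -> R) (la lb M : R) :
  a @ \oo --> la -> b @ \oo --> lb -> (forall k, (2 <= k)%N -> `|a k - b k| <= M) ->
  `|la - lb| <= M.
Proof.
move=> ala blb abM.
have H : (fun k => `|a k - b k|) @ \oo --> `|la - lb|.
  by apply: cvg_norm; exact: cvgB.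
rewrite -(cvg_lim _ H) //; apply: limr_le; first by apply/cvg_ex; exists `|la - lb|.
by exists 2%N => // k /= k2; exact: abM.
Qed.

(** Without its terms of degree 0 and 1, the power series is quadratically small
    at its centre. *)
Lemma analytic_differentiable F z0 : analytic_at F z0 -> differentiable F z0.
Proof.
move=> [r [P [r0 hP cvP FP]]].
pose a k := coeff_norm (P k) * r ^+ k.
have a0 k : 0 <= a k.
  by rewrite mulr_ge0 ?exprn_ge0 ?(ltW r0) // /coeff_norm sumr_ge0.
pose M := limn (series a).
have aM k : series a k <= M.
  apply: nondecreasing_cvgn_le; last exact: cvP.
  exact: nondecreasing_series.
pose G z := peval (P 0%N + P 1%N) (z - z0).
have dG : differentiable G z0.
  apply: (@differentiable_comp _ _ _ _ (fun z => z - z0) (peval (P 0%N + P 1%N))).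
    by apply: differentiableB => //; exact: differentiable_cst.
  exact: peval_differentiable.
have -> : F = G + (F - G) by rewrite addrC subrK.
apply: differentiableD => //.
apply: (@quadratically_small_differentiable R _ _ _ (M / r ^+ 2) r r0) => w wr.
have coord i : `|w 0 i - z0 0 i| <= `|w - z0|.
  by have := coord_le_norm (w - z0) i; rewrite !mxE.
have lim := FP w (fun i => le_lt_trans (coord i) wr).
set s := `|w - z0| in wr coord *.
have s0 : 0 <= s by exact: normr_ge0.
apply: (limit_dist_le lim (cvg_cst (G w))) => k k2 /=.
have -> : series (fun k => peval (P k) (w - z0)) k - G w
          = \sum_(2 <= j < k) peval (P j) (w - z0).
  rewrite /series /= (big_cat_nat _ k2) //= big_nat_recl // big_nat1.
  have -> : G w = peval (P 0%N) (w - z0) + peval (P 1%N) (w - z0).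
    by rewrite /G pevalD.
  by ring.
apply: (le_trans (ler_norm_sum _ _ _)).
apply: (@le_trans _ _ (\sum_(2 <= j < k) a j * (s / r) ^+ 2)).
  rewrite big_nat_cond [leRHS]big_nat_cond; apply: ler_sum => j.
  rewrite andbT => /andP[j2 _].
  have hv : `|peval (P j) (w - z0)| <= coeff_norm (P j) * s ^+ j.
    by apply: homogeneous_value => // i; rewrite !mxE.
  apply: (le_trans hv); rewrite /a -mulrA ler_wpM2l //.
    by rewrite /coeff_norm sumr_ge0.
  have -> : s ^+ j = r ^+ j * (s / r) ^+ j.
    by rewrite -exprMn mulrC divfK // gt_eqF.
  rewrite ler_wpM2l ?exprn_ge0 ?(ltW r0) //.
  apply: ler_wiXn2l => //; first by rewrite divr_ge0 // ltW.
  by rewrite ler_pdivrMr // mul1r ltW.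
have -> : M / r ^+ 2 * s ^+ 2 = M * (s / r) ^+ 2 by rewrite exprMn exprVn; ring.
rewrite -mulr_suml; apply: ler_wpM2r; first by rewrite sqr_ge0.
apply: le_trans (aM k); rewrite /series /= [leRHS](big_cat_nat _ k2) //= lerDr.
exact: sumr_ge0.
Qed.

(** The factor [mu ^ k] is the gain obtained by leaving out the components
    [m < k] of a seed. *)
Lemma classD_lips (d k : nat) (C mu : R) (f : seed R N) (P : pred 'I_N.+1) :
  classD d.+1 C mu f -> (forall m, P m -> (k <= m)%N) ->
  lips d ((sites N)%:R * (N.+1%:R * (d.+1%:R * (C * mu ^+ k))))
    (peval (cyc (\sum_(m < N.+1 | P m) f m))).
Proof.
move=> [C0 /andP[mu0 mu1] fD] Pk; apply: lips_cyc.
have c0 : 0 <= d.+1%:R * (C * mu ^+ k).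
  by rewrite !mulr_ge0 ?exprn_ge0 // ltW.
apply: (lips_le (K := \sum_(m < N.+1 | P m) (d.+1%:R * (C * mu ^+ k)))).
  rewrite sumr_const -[leLHS]mulr_natl ler_wpM2r // ler_nat.
  by rewrite (leq_trans (max_card _)) // card_ord.
apply: lips_sum => m Pm.
have [hm _ cm] := fD m (leq_ord m).
apply: homogeneous_lips => //; apply: (le_trans cm).
by rewrite ler_pM2l // ler_wiXn2l ?(ltW mu0) ?(ltW mu1) // Pk.
Qed.

Lemma geometric_half_sum (k : nat) : \sum_(2 <= s < k) (2^-1 : R) ^+ (s - 2) <= 2.
Proof.
rewrite -(add0n 2%N) big_addn.
have H (m : nat) : \sum_(0 <= i < m) (2^-1 : R) ^+ (i + 2 - 2) = 2 - 2 * 2^-1 ^+ m.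
  elim: m => [|m IH]; first by rewrite big_geq // expr0; ring.
  by rewrite big_nat_recr //= IH addnK exprS; field.
by rewrite add0n H gerBl mulr_ge0 // exprn_ge0.
Qed.

Lemma even_le_geometric (s : nat) : (2 <= s)%N -> (s.*2 + 2 <= 6 * 2 ^ (s - 2))%N.
Proof.
case: s => [|[|s]] // _; rewrite !subSS subn0.
elim: s => // s IH; rewrite expnS mulnCA !doubleS.
rewrite -[X in (X <= _)%N]/((s.+2.*2 + 2).+2); move: IH; set x := (_.*2 + 2)%N => IH.
have x2 : (2 <= x)%N by rewrite /x addnC.
by apply: (@leq_trans (2 * x)%N); [rewrite mul2n -addnn -addn2 leq_add2l|rewrite leq_mul2l].
Qed.

Section NormalForm.
Variables (Czeta0 Ch1 Ctil eps : R) (nf : nf_data R N).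
Hypothesis Ctil0 : 0 < Ctil.
Hypothesis NF : normal_form Czeta0 Ch1 Ctil eps nf.
Local Notation D := (@nf_domain R N Czeta0 Ch1 eps).

Lemma domain_P2 z : D z ->
  cvgn (fun n => \sum_(2 <= s < n) peval (Hnf eps nf s) z) /\
  differentiable (P2 eps nf) z.
Proof.
move=> [rho [rho0 zr]]; have [c an] := nf_remainder NF rho0 zr.
by split=> //; exact: analytic_differentiable.
Qed.

Lemma Ch1_gt0 : 0 < Ch1.
Proof. by have [] := nf_zeta1 NF. Qed.

Definition P2_const := 24 * (sites N)%:R * N.+1%:R * Ctil * Ch1.

Lemma Hnf_lips s : (2 <= s)%N ->
  lips (s.*2.+1) ((sites N)%:R * (N.+1%:R * ((s.*2.+2)%:R * (2 * Ctil ^+ s.-1 * Ch1))))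
    (peval (Hnf eps nf s)).
Proof.
move=> s2; have := nf_eta NF s2; rewrite addn2 => etaD.
have -> : Hnf eps nf s = cyc (\sum_(m < N.+1 | true) eta nf s m).
  by case: s s2 {etaD} => [|[|s]].
by have := @classD_lips _ 0%N _ _ _ xpredT etaD (fun _ _ => isT); rewrite expr0 mulr1.
Qed.

Lemma P2_at0 : P2 eps nf 0 = 0.
Proof.
rewrite /P2 (_ : (fun n => _) = cst 0) ?lim_cst //.
apply/funext => k; rewrite big_nat_cond big1 // => s; rewrite andbT => /andP[s2 _].
exact: (Hnf_lips s2).1.
Qed.

(** Up to a factor independent of [s], the term of degree [2 s + 2] contributes
    [(2 s + 2) Ctil (Ctil r^2) ^ (s - 2) r^5]; as [2 s + 2 <= 6 * 2 ^ (s - 2)] and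
    [Ctil r^2 <= 1 / 4], the series is dominated by a geometric one of ratio 1/2,
    and the term [s = 2] gives the power of [r]. *)
Lemma P2_lipschitz (r d : R) z w : D z -> D w ->
  (forall i, `|z 0 i| <= r) -> (forall i, `|w 0 i| <= r) ->
  (forall i, `|z 0 i - w 0 i| <= d) -> Ctil * r ^+ 2 <= 1 / 4 ->
  `|P2 eps nf z - P2 eps nf w| <= P2_const * r ^+ 5 * d.
Proof.
move=> Dz Dw zr wr zw rsmall.
have r0 := radius_ge0 zr.
have d0 : 0 <= d by apply: (@radius_ge0 _ _ _ (z - w)) => i; rewrite !mxE.
have C0 := Ch1_gt0.
have [[cz _] [cw _]] := (domain_P2 Dz, domain_P2 Dw).
apply: (limit_dist_le cz cw) => k _; rewrite -sumrB.
apply: (le_trans (ler_norm_sum _ _ _)).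
pose K : R := 12 * (sites N)%:R * N.+1%:R * Ctil * Ch1 * r ^+ 5 * d.
have K0 : 0 <= K by rewrite !mulr_ge0 ?exprn_ge0 // ltW.
apply: (@le_trans _ _ (K * \sum_(2 <= s < k) (2^-1 : R) ^+ (s - 2))); last first.
  have -> : P2_const * r ^+ 5 * d = K * 2 by rewrite /P2_const /K; ring.
  by rewrite ler_wpM2l // geometric_half_sum.
rewrite mulr_sumr big_nat_cond [leRHS]big_nat_cond; apply: ler_sum => s.
rewrite andbT => /andP[s2 _].
apply: (le_trans ((Hnf_lips s2).2 r d z w zr wr zw)).
have p1 : (s.*2.+2)%:R <= 6 * 2 ^+ (s - 2) :> R.
  by rewrite -natrX -natrM ler_nat -addn2 even_le_geometric.
have p2 : (Ctil * r ^+ 2) ^+ (s - 2) <= (4^-1 : R) ^+ (s - 2).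
  rewrite lerXn2r ?nnegrE ?mulr_ge0 ?sqr_ge0 ?(ltW Ctil0) //.
  by move: rsmall; rewrite mul1r.
have es : Ctil ^+ s.-1 * r ^+ s.*2.+1 = Ctil * r ^+ 5 * (Ctil * r ^+ 2) ^+ (s - 2).
  case: s s2 {p1 p2} => [|[|s]] // _; rewrite !subSS subn0 /= exprMn -exprM.
  rewrite exprS !doubleS (_ : s.*2.+4.+1 = (5 + 2 * s)%N); last by rewrite mul2n.
  by rewrite exprD; ring.
have -> : (sites N)%:R * (N.+1%:R * ((s.*2.+2)%:R * (2 * Ctil ^+ s.-1 * Ch1)))
          * r ^+ s.*2.+1 * d
  = 2 * (sites N)%:R * N.+1%:R * Ch1 * d
    * ((s.*2.+2)%:R * (Ctil ^+ s.-1 * r ^+ s.*2.+1)) by ring.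
have -> : K * 2^-1 ^+ (s - 2) = 2 * (sites N)%:R * N.+1%:R * Ch1 * d
    * (6 * 2 ^+ (s - 2) * (Ctil * r ^+ 5 * (4^-1) ^+ (s - 2))).
  have -> : (4^-1 : R) ^+ (s - 2) = 2^-1 ^+ (s - 2) * 2^-1 ^+ (s - 2).
    by rewrite -exprMn; congr (_ ^+ _); field.
  have h : 2 ^+ (s - 2) * 2^-1 ^+ (s - 2) = 1 :> R.
    by rewrite -exprMn mulfV ?expr1n // pnatr_eq0.
  rewrite /K; transitivity (12 * (sites N)%:R * N.+1%:R * Ctil * Ch1 * r ^+ 5 * d
    * 2^-1 ^+ (s - 2) * (2 ^+ (s - 2) * 2^-1 ^+ (s - 2))); last by ring.
  by rewrite h mulr1.
rewrite ler_wpM2l ?mulr_ge0 ?(ltW C0) // ler_pM ?mulr_ge0 ?exprn_ge0 //.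
  by rewrite ltW.
by rewrite es ler_wpM2l // mulr_ge0 ?exprn_ge0 // ltW.
Qed.

End NormalForm.

End Remainder.

(** * Confinement and mean value estimates *)

Section Confinement.
Context {R : realType}.

Lemma derivable_near (f : R -> R) (s e : R) : derivable f s 1 -> 0 < e ->
  exists2 d, 0 < d & forall u, `|u - s| < d -> `|f u - f s| < e.
Proof.
move=> /derivable1_diffP/differentiable_continuous/cvgrPdist_lt/(_ e) cf e0.
have [d d0 fd] := cf e0; exists d => // u us; rewrite distrC; apply: fd.
by rewrite /ball /= distrC.
Qed.

(** At the supremum of the times up to which [f < c], continuity gives [f <= c];
    the hypothesis makes this strict, so that [f < c] persists a little longer. *)
Lemma trap (f : R -> R) (c T : R) : f 0 < c ->
  (forall s, 0 <= s <= T -> derivable f s 1) ->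
  (forall s, 0 <= s <= T -> (forall u, 0 <= u <= s -> f u <= c) -> f s < c) ->
  forall s, 0 <= s <= T -> f s < c.
Proof.
move=> f0 fd fc t /andP[t0 tT].
have cf s e : 0 <= s <= t -> 0 < e ->
    exists2 d, 0 < d & forall u, `|u - s| < d -> `|f u - f s| < e.
  move=> /andP[s0 st]; apply: derivable_near; apply: fd.
  by rewrite s0 (le_trans st).
pose B := [set s | 0 <= s <= t /\ forall u, 0 <= u <= s -> f u < c].
have B0 : B 0.
  split=> [|u]; first by rewrite lexx.
  by rewrite -eq_le => /eqP <-.
have Bub : ubound B t by move=> s [/andP[]].
have supB : has_sup B by split; [exists 0|exists t].
set b := sup B.
have b0 : 0 <= b by apply: ub_le_sup => //; exact: supB.2.
have bt : b <= t by apply: ge_sup => //; exists 0.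
have below u : 0 <= u -> u < b -> f u < c.
  move=> u0 ub; have [s [_ Bs] us] := sup_gt (ex_intro _ 0 B0) ub.
  by apply: Bs; rewrite u0 ltW.
have btb : 0 <= b <= t by rewrite b0.
have fb : f b <= c.
  rewrite leNgt; apply/negP => cb.
  have [|d d0 hd] := cf b (f b - c) btb; first by rewrite subr_gt0.
  have b1 : 0 < b.
    rewrite lt_neqAle b0 andbT; apply/negP => /eqP E; move: cb f0; rewrite -E; lra.
  pose u := Num.max 0 (b - d / 2).
  have ub : u < b by rewrite /u gt_max b1 /=; lra.
  have u0 : 0 <= u by rewrite le_max lexx.
  have ud : b - d / 2 <= u by rewrite le_max lexx orbT.
  have := hd u; rewrite ltr0_norm ?subr_lt0 // => /(_ _) h.
  have := below u u0 ub; have : `|f u - f b| < f b - c by apply: h; lra.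
  by rewrite ltr_norml => /andP[]; lra.
have {}fb : f b < c.
  apply: fc; first by rewrite b0 (le_trans bt).
  move=> u /andP[u0]; rewrite le_eqVlt => /predU1P[->//|ub].
  by apply/ltW/below.
have [|d d0 hd] := cf b (c - f b) btb; first by rewrite subr_gt0.
have ext u : 0 <= u -> u < b + d -> f u < c.
  move=> u0 ubd; have [/(below _ u0)//|bu] := ltP u b.
  have : `|f u - f b| < c - f b by apply: hd; rewrite ger0_norm ?subr_ge0 //; lra.
  by rewrite ltr_norml => /andP[]; lra.
have [tb|bt'] := leP t b; first by apply: ext => //; lra.
pose s := Num.min t (b + d / 2).
have sB : B s.
  split.
    by rewrite le_min t0 /= ge_min lexx andbT; lra.
  move=> u /andP[u0 us]; apply: ext => //; apply: (le_lt_trans us).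
  by rewrite gt_min; apply/orP; right; lra.
have : s <= b by apply: ub_le_sup => //; exact: supB.2.
by rewrite ge_min => /orP[]; lra.
Qed.

End Confinement.

Section PhaseEstimates.
Context {R : realType} {N : nat}.
Notation n := (sites N + sites N)%N.
Implicit Types (u v w z : phase R N) (F G : phase R N -> R).

Lemma is_derive_dotl u (f : R -> phase R N) (t : R) v :
  is_derive t 1 f v -> is_derive t 1 (fun s => dot u (f s)) (dot u v).
Proof.
move=> fd; pose h (i : 'I_n) (s : R) : R := u 0 i * f s 0 i.
have hd i : is_derive t 1 (h i) (u 0 i * v 0 i).
  have fi := is_derive_coord i fd.
  by have := is_deriveZ (u 0 i) fi.
have := @is_derive_sum R R R n h t 1 _ hd.
rewrite /dot; congr (is_derive _ _ _ _).
by apply/funext => s; rewrite fct_sumE.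
Qed.

(** With [e = X z - X w], the scalar mean value theorem for [dot e X] along the
    segment yields the Lipschitz constant [K] for the Euclidean norm itself. *)
Lemma mean_value_enorm (X : phase R N -> phase R N) z w (K : R) :
  (forall s, 0 <= s <= 1 -> differentiable X (w + s *: (z - w))) ->
  (forall s, 0 <= s <= 1 ->
     forall v, enorm ('d X (w + s *: (z - w)) v) <= K * enorm v) ->
  enorm (X z - X w) <= K * enorm (z - w).
Proof.
move=> dX XK.
pose l (s : R) := w + s *: (z - w).
have ld (s : R) : is_derive s 1 l (z - w).
  apply: is_derive_row => i.
  rewrite (_ : (fun s => l s 0 i) = (fun s => w 0 i + (z - w) 0 i * s)); last first.
    by apply/funext => x; rewrite /l !mxE mulrC.
  have h := is_deriveD (is_derive_cst (w 0 i) s (1 : R))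
                       (is_deriveZ ((z - w) 0 i) (is_derive_id s (1 : R))).
  by apply: (is_derive_eq h); rewrite add0r /GRing.scale /= mulr1.
pose e := X z - X w.
pose g (s : R) := dot e (X (l s)).
have gd (s : R) : 0 <= s <= 1 -> is_derive s 1 g (dot e ('d X (l s) (z - w))).
  move=> s01; apply: (@is_derive_dotl e (X \o l)).
  have dl := ld s; have dXl := dX s s01.
  have ddl : differentiable l s by apply/derivable1_diffP; case: dl.
  have dc : differentiable (X \o l) s by exact: differentiable_comp.
  split; first exact/derivable1_diffP.
  rewrite deriveE // diff_comp //=.
  have -> : 'd l s 1 = z - w by rewrite -deriveE // derive_val.
  by [].
have gd01 (x : R) : x \in `]0, 1[ -> is_derive x 1 g (dot e ('d X (l x) (z - w))).
  by rewrite in_itv /= => /andP[/ltW ? /ltW ?]; apply: gd; apply/andP.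
have [c] := MVT_segment ler01 gd01 (is_derive_continuous_within gd).
rewrite in_itv /= => c01; rewrite subr0 mulr1 /g.
have -> : l 1 = z by rewrite /l scale1r addrC subrK.
have -> : l 0 = w by rewrite /l scale0r addr0.
rewrite -dotBr -/e -enorm_sqr => E.
have [e0|e0] := leP (enorm e) 0.
  have := enorm_ge0 e; have := XK 0 _ (z - w).
  rewrite lexx ler01 => /(_ isT) h ?.
  by apply: (le_trans e0); apply: le_trans h; exact: enorm_ge0.
have : enorm e ^+ 2 <= enorm e * (K * enorm (z - w)).
  rewrite E; apply: (le_trans (dot_le_enorm _ _)).
  by rewrite ler_pM2l //; exact: XK.
by rewrite expr2 ler_pM2l.
Qed.

Lemma rotateD u v : rotate (u + v) = rotate u + rotate v.
Proof.
have addE (a b : phase R N) i : (a + b) 0 i = a 0 i + b 0 i by rewrite !mxE.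
apply: phase_ext => j; rewrite addE ?rotateE_q ?rotateE_p addE //.
by rewrite opprD.
Qed.

Lemma hamvfD F G z : differentiable F z -> differentiable G z ->
  hamvf (F + G) z = hamvf F z + hamvf G z.
Proof.
move=> dF dG; rewrite !hamvf_rotate -rotateD; congr rotate; apply/rowP => i.
by rewrite !mxE /partial deriveD //; exact: diff_derivable.
Qed.

Lemma hamvf_sub F G z : differentiable F z -> differentiable G z ->
  hamvf (F - G) z = hamvf F z - hamvf G z.
Proof.
move=> dF dG; rewrite !hamvf_rotate -rotateB; congr rotate; apply/rowP => i.
by rewrite !mxE /partial deriveB //; exact: diff_derivable.
Qed.

(** Local Lipschitz constants bound the partial derivatives; vector fields of
    series are thereby estimated without termwise differentiation. *)
Lemma hamvf_le F z (K r : R) : differentiable F z -> 0 < r -> 0 <= K ->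
  (forall w (d : R), (forall i, `|w 0 i - z 0 i| <= d) -> d < r ->
     `|F w - F z| <= K * d) ->
  enorm (hamvf F z) <= n%:R * K.
Proof.
move=> dF r0 K0 FK; rewrite hamvf_rotate enorm_rotate.
apply: enorm_le_coord => // i; rewrite mxE /partial.
apply: (derive_le_lipschitz r0); first exact: diff_derivable.
move=> h hr; apply: FK => // k; rewrite !mxE addrK eqxx /=.
rewrite normrM ler_piMr // -[X in X%:R]/((k == i) : nat).
by case: (k == i); rewrite ?normr1 ?normr0 // ler01.
Qed.

Lemma hamvf_linear_le p z (K : R) : 0 <= K -> lips 1 K (peval p) ->
  enorm (hamvf (peval p) z) <= n%:R * (K * enorm z).
Proof.
move=> K0 [_ lp]; apply/ler_addgt0Pr => e e0.
pose d0 : R := e / (n%:R * (K + 1)).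
have nK : 0 < n%:R * (K + 1) :> R by rewrite mulr_gt0 ?ltr0n // ltr_wpDl.
have d00 : 0 < d0 by rewrite divr_gt0.
apply: (@le_trans _ _ (n%:R * (K * (enorm z + d0)))).
  apply: (@hamvf_le _ _ _ d0) => //.
  - exact: peval_differentiable.
  - by rewrite mulr_ge0 // addr_ge0 ?enorm_ge0 // ltW.
  move=> w d wd dd0.
  rewrite -[X in K * X * d]expr1; apply: lp => // i.
    have -> : w 0 i = (w 0 i - z 0 i) + z 0 i by rewrite subrK.
    apply: (le_trans (ler_normD _ _)); rewrite addrC lerD ?coord_le_enorm //.
    by apply: (le_trans (wd i)); exact: ltW.
  by apply: (le_trans (coord_le_enorm z i)); rewrite lerDl ltW.
rewrite mulrDr mulrDr lerD2l mulrA.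
have -> : e = n%:R * (K + 1) * d0 by rewrite /d0 mulrC divfK // gt_eqF.
by rewrite ler_wpM2r ?(ltW d00) // ler_wpM2l // lerDl.
Qed.

End PhaseEstimates.

(** * The chain and its effective Hamiltonian *)

Section Chain.
Context {R : realType} {N : nat}.
Notation n := (sites N + sites N)%N.
Implicit Types (z w : phase R N) (eps : R).

Definition H0 (eps : R) : poly R N := HOmega N eps + Z0 N eps.

Lemma zeta0_coupling (eps : R) m : zeta0 N eps m =
  (if m == 0%N then 0 else bcoef N eps m) *: coupling 0 (inord m) :> poly R N.
Proof. by rewrite /zeta0; case: ifP => // _; rewrite scale0r. Qed.

Lemma cyc_zeta0 (eps : R) m : cyc (zeta0 N eps m) =
  \sum_(l < sites N) (if m == 0%N then 0 else bcoef N eps m) *: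
    coupling (iter l (@ordS _) 0) (iter l (@ordS _) (inord m)).
Proof.
by rewrite zeta0_coupling /cyc; apply: eq_bigr => l _; exact: iter_tau_coupling.
Qed.

Lemma gauge_invariant_cyc_zeta0 eps m : gauge_invariant (cyc (zeta0 N eps m)).
Proof.
rewrite cyc_zeta0; apply: gauge_invariant_sum => l _.
by apply: gauge_invariantZ; exact: gauge_invariant_coupling.
Qed.

Lemma linear_gradient_cyc_zeta0 eps m : linear_gradient (cyc (zeta0 N eps m)).
Proof.
rewrite cyc_zeta0; apply: linear_gradient_sum => l _.
by apply: linear_gradientZ; exact: linear_gradient_coupling.
Qed.

Lemma HOmega_coupling eps :
  HOmega N eps = (Omega N eps / 2) *: \sum_j coupling j j :> poly R N.
Proof. by rewrite /HOmega; congr (_ *: _); apply: eq_bigr => j _; rewrite !expr2. Qed.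

Lemma gauge_invariant_HOmega eps : gauge_invariant (HOmega N eps : poly R N).
Proof.
rewrite HOmega_coupling; apply: gauge_invariantZ; apply: gauge_invariant_sum => j _.
exact: gauge_invariant_coupling.
Qed.

Lemma linear_gradient_HOmega eps : linear_gradient (HOmega N eps : poly R N).
Proof.
rewrite HOmega_coupling; apply: linear_gradientZ; apply: linear_gradient_sum => j _.
exact: linear_gradient_coupling.
Qed.

Lemma Z0_sum eps : Z0 N eps = \sum_(m < N.+1) cyc (zeta0 N eps m) :> poly R N.
Proof. by rewrite /Z0 /seed_sum cyc_sum. Qed.

Lemma gauge_invariant_H0 eps : gauge_invariant (H0 eps).
Proof.
apply: gauge_invariantD; first exact: gauge_invariant_HOmega.
rewrite Z0_sum; apply: gauge_invariant_sum => m _; exact: gauge_invariant_cyc_zeta0.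
Qed.

Lemma linear_gradient_H0 eps : linear_gradient (H0 eps).
Proof.
apply: linear_gradientD; first exact: linear_gradient_HOmega.
rewrite Z0_sum; apply: linear_gradient_sum => m _; exact: linear_gradient_cyc_zeta0.
Qed.

Lemma peval_HOmega eps z : peval (HOmega N eps) z = Omega N eps / 2 * dot z z.
Proof.
rewrite HOmega_coupling pevalZ; congr (_ * _); rewrite dot_split.
rewrite (big_morph (fun p => peval p z) (id1 := 0) (op1 := +%R)); first last.
- by rewrite peval0.
- by move=> p q; rewrite pevalD.
by apply: eq_bigr => j _; rewrite /coupling pevalD !pevalM /GRing.add /GRing.mul /= !peval_var.
Qed.

Lemma lips_HOmega eps : 0 <= Omega N eps ->
  lips 1 (Omega N eps * n%:R) (peval (HOmega N eps : poly R N)).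
Proof.
move=> Om0; split=> [|r d z w zr wr zw].
  by rewrite peval_HOmega /dot big1 ?mulr0 // => i _; rewrite mxE mul0r.
rewrite !peval_HOmega -mulrBr normrM ger0_norm ?divr_ge0 //.
have -> : Omega N eps * n%:R * r ^+ 1 * d = Omega N eps / 2 * (n%:R * (2 * r * d)).
  by rewrite expr1; field.
rewrite ler_wpM2l ?divr_ge0 // -sumrB; apply: (le_trans (ler_norm_sum _ _ _)).
have -> : n%:R * (2 * r * d) = \sum_(i < n) 2 * r * d.
  by rewrite sumr_const card_ord mulr_natl.
apply: ler_sum => i _.
have -> : z 0 i * z 0 i - w 0 i * w 0 i = (z 0 i + w 0 i) * (z 0 i - w 0 i) by ring.
rewrite normrM ler_pM //; apply: (le_trans (ler_normD _ _)).
by rewrite mulr_natl mulr2n lerD.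
Qed.

(** A cyclically symmetric function is the sum of [2 N + 1] shifts of a seed with
    [N + 1] components. *)
Definition seed_factor : R := (sites N)%:R * N.+1%:R.

Lemma seed_factor_ge0 : 0 <= seed_factor.
Proof. exact: mulr_ge0. Qed.

(** [H - HOmega] is at most [energy_const * eps * rho] on the ball of radius
    [rho^(1/2)]. *)
Definition energy_const (Czeta0 Ch1 Ctil : R) : R :=
  seed_factor * (4 * Czeta0 + 4 * Ch1) + @P2_const R N Ch1 Ctil.

(** The vector fields of [H] and of [Keff] differ by at most
    [residual_const * eps^2 * rho^(1/2)] on the ball of radius [rho^(1/2)]. *)
Definition residual_const (Czeta0 Ch1 Ctil : R) : R :=
  n%:R * (seed_factor * (16 * Czeta0 + 64 * Ch1) + 32 * @P2_const R N Ch1 Ctil).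

Section Dynamics.
Variables (Czeta0 Ch1 Ctil C1 c0 c1 kap eps rho : R) (nf : nf_data R N).
Hypothesis N1 : (1 <= N)%N.
Hypothesis Ctil0 : 0 < Ctil.
Hypothesis NF : normal_form Czeta0 Ch1 Ctil eps nf.
Hypothesis XNb : XN_differential_bound Czeta0 Ch1 C1 c0 eps nf.
Hypothesis zeta0D : classD 2 Czeta0 (2 * eps) (zeta0 N eps : seed R N).
Hypothesis rho0 : 0 < rho.
Hypothesis rho_eps : rho <= eps.
Hypothesis Omega0 : 0 < Omega N eps.
Hypothesis c1P : 2 / 3 < c1 <= 1.
Hypothesis c1c0 : c1 <= c0.
Hypothesis rho_small : 9 * n%:R ^+ 2 * rho < rho_star N Czeta0 Ch1 eps.
Hypothesis rho_Ctil : Ctil * (4 * rho) <= 1 / 4.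
Hypothesis eps_energy :
  4 * energy_const Czeta0 Ch1 Ctil * eps < Omega N eps * (c1 ^+ 2 - 4 / 9).
Hypothesis kap0 : 0 < kap.
Hypothesis kapP : C1 * Ch1 / (1 - (2 * eps) `^ (1 / 4)) ^+ 2 <= kap.

Local Notation D := (@nf_domain R N Czeta0 Ch1 eps).
Local Notation H := (H1nf eps nf).
Local Notation K := (peval (Keff eps nf)).
Local Notation Z1 := (cyc (seed_sum (zeta1 nf))).
Let s : R := Num.sqrt rho.

Let s0 : 0 < s. Proof. by rewrite sqrtr_gt0. Qed.
Let ss : s ^+ 2 = rho. Proof. by rewrite sqr_sqrtr // ltW. Qed.
Let n1 : 1 <= n%:R :> R. Proof. by rewrite ler1n. Qed.
Let eps0 : 0 < eps. Proof. exact: lt_le_trans rho0 rho_eps. Qed.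
Let eps_lt : 2 * eps < 1. Proof. by have [_ /andP[]] := zeta0D. Qed.
Let Ch10 : 0 < Ch1. Proof. exact: Ch1_gt0 NF. Qed.
Let Cz0 : 0 < Czeta0. Proof. by have [] := zeta0D. Qed.

Let P2c0 : 0 <= @P2_const R N Ch1 Ctil.
Proof. by rewrite /P2_const !mulr_ge0 // ltW. Qed.

Let CC0 : 0 <= 16 * Czeta0 + 64 * Ch1.
Proof. by rewrite addr_ge0 // mulr_ge0 // ltW. Qed.

Let rc0 : 0 <= residual_const Czeta0 Ch1 Ctil.
Proof.
rewrite /residual_const mulr_ge0 // addr_ge0 // mulr_ge0 //.
exact: seed_factor_ge0.
Qed.

Let rho_star_gt : rho < rho_star N Czeta0 Ch1 eps.
Proof.
apply: le_lt_trans rho_small; rewrite ler_peMl ?(ltW rho0) //.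
have : 1 <= n%:R ^+ 2 :> R by rewrite exprn_ege1.
lra.
Qed.

(** The normal form is controlled on the whole cube of half-side [2 rho^(1/2)]. *)
Let cube_norm z : (forall i, `|z 0 i| <= 2 * s) ->
  enorm z <= 2 / 3 * (9 * n%:R ^+ 2 * rho) `^ (1 / 2).
Proof.
move=> zc; have h0 : 0 <= 9 * n%:R ^+ 2 * rho by rewrite !mulr_ge0 // ltW.
rewrite div1r powR12_sqrt // -[rho]ss.
have -> : 9 * n%:R ^+ 2 * s ^+ 2 = (3 * n%:R * s) ^+ 2 by ring.
rewrite sqrtr_sqr ger0_norm; last by rewrite !mulr_ge0 // ltW.
apply: (le_trans (enorm_le_coord _ zc)); first by rewrite mulr_ge0 // ltW.
by rewrite le_eqVlt; apply/orP; left; apply/eqP; field.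
Qed.

Let big_rho : 0 < 9 * n%:R ^+ 2 * rho < rho_star N Czeta0 Ch1 eps.
Proof. by rewrite rho_small !mulr_gt0 // exprn_gt0 // (lt_le_trans ltr01). Qed.

Lemma cube_domain z : (forall i, `|z 0 i| <= 2 * s) -> D z.
Proof. by move=> zc; exists (9 * n%:R ^+ 2 * rho); split=> //; exact: cube_norm. Qed.

Lemma ball_cube z : enorm z <= s -> forall i, `|z 0 i| <= 2 * s.
Proof.
move=> zs i; apply: (le_trans (coord_le_enorm z i)); apply: (le_trans zs).
by rewrite ler_peMl ?ler1n // ltW.
Qed.

Lemma H_decomposition :
  H = peval (HOmega N eps + Z0 N eps) + (fun z => peval Z1 z + P2 eps nf z).
Proof.
by apply/funext => z; rewrite /H1nf pevalD fctE addrA.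
Qed.

Lemma differentiable_Z1P2 z : D z ->
  differentiable (fun z => peval Z1 z + P2 eps nf z) z.
Proof.
move=> Dz; apply: differentiableD; first exact: peval_differentiable.
exact: (domain_P2 NF Dz).2.
Qed.

Lemma differentiable_H z : D z -> differentiable H z.
Proof.
move=> Dz; rewrite H_decomposition; apply: differentiableD.
  exact: peval_differentiable.
exact: differentiable_Z1P2.
Qed.

Lemma hamvf_H z : D z -> hamvf H z = hamvf (peval (H0 eps)) z + XN eps nf z.
Proof.
move=> Dz; rewrite H_decomposition hamvfD //.
  exact: peval_differentiable.
exact: differentiable_Z1P2.
Qed.

Let seed_const (a b : R) :
  (sites N)%:R * (N.+1%:R * (a * b)) = seed_factor * a * b.
Proof. by rewrite /seed_factor; ring. Qed.

Lemma Z0_tail : Z0 N eps = cyc (\sum_(m < N.+1 | (0 < m)%N) zeta0 N eps m) :> poly R N.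
Proof.
rewrite Z0_sum -cyc_sum; congr cyc.
by rewrite [LHS](bigID (fun m : 'I_N.+1 => 0 < m)%N) /= [X in _ + X]big1 ?addr0 //;
   move=> m; rewrite -eqn0Ngt /zeta0 => ->.
Qed.

Lemma lips_Z0 : lips 1 (seed_factor * 2 * (Czeta0 * (2 * eps))) (peval (Z0 N eps)).
Proof.
rewrite Z0_tail -seed_const -[X in Czeta0 * X]expr1.
exact: (classD_lips (d := 1) (k := 1) zeta0D).
Qed.

Lemma lips_Z1 : lips 3 (seed_factor * 4 * Ch1) (peval Z1).
Proof.
have -> : seed_factor * 4 * Ch1 = (sites N)%:R * (N.+1%:R * (4 * (Ch1 * (2 * eps) ^+ 0))).
  by rewrite expr0 mulr1 seed_const.
by rewrite /seed_sum; exact: (classD_lips (d := 3) (k := 0) (P := xpredT) (nf_zeta1 NF)).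
Qed.

Lemma H_energy z : enorm z <= s ->
  `|H z - Omega N eps / 2 * dot z z| <= energy_const Czeta0 Ch1 Ctil * (eps * rho).
Proof.
move=> zs.
have zi i : `|z 0 i| <= s by apply: (le_trans (coord_le_enorm z i)).
have Dz : D z by apply/cube_domain/ball_cube.
have D0 : D 0.
  by apply: cube_domain => i; rewrite mxE normr0 mulr_ge0 // ltW.
have h0 := lips_value lips_Z0 zi.
have h1 := lips_value lips_Z1 zi.
have h2 : `|P2 eps nf z| <= @P2_const R N Ch1 Ctil * s ^+ 5 * s.
  rewrite -[P2 eps nf z]subr0 -(P2_at0 NF); apply: (P2_lipschitz Ctil0 NF Dz D0 zi).
  - by move=> i; rewrite mxE normr0 ltW.
  - by move=> i; rewrite mxE subr0.
  by rewrite ss; apply: le_trans rho_Ctil; rewrite ler_pM2l // ler_peMl ?ler1n ?ltW.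
have -> : H z - Omega N eps / 2 * dot z z
          = peval (Z0 N eps) z + peval Z1 z + P2 eps nf z.
  by rewrite /H1nf !pevalD !fctE peval_HOmega; ring.
apply: (le_trans (ler_normD _ _)); apply: (le_trans (lerD (ler_normD _ _) (lexx _))).
apply: (le_trans (lerD (lerD h0 h1) h2)).
have r2 : rho ^+ 2 <= eps * rho by rewrite expr2 ler_pM2r.
have r3 : rho ^+ 3 <= eps * rho.
  apply: le_trans r2; rewrite exprS ler_piMl ?sqr_ge0 //.
  by apply: (le_trans rho_eps); move: eps_lt eps0; lra.
have -> : s ^+ 4 = rho ^+ 2 by rewrite -ss -exprM.
have -> : s ^+ 2 = rho by [].
have -> : @P2_const R N Ch1 Ctil * s ^+ 5 * s = @P2_const R N Ch1 Ctil * rho ^+ 3.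
  by rewrite -ss -exprM -mulrA -exprSr.
have e1 : seed_factor * 4 * Ch1 * rho ^+ 2 <= seed_factor * 4 * Ch1 * (eps * rho).
  by rewrite ler_wpM2l // !mulr_ge0 ?seed_factor_ge0 // ltW.
have e2 : @P2_const R N Ch1 Ctil * rho ^+ 3 <= @P2_const R N Ch1 Ctil * (eps * rho).
  by rewrite ler_wpM2l.
rewrite /energy_const; lra.
Qed.

(** Conservation of energy, which is a small perturbation of [Omega |z|^2 / 2],
    keeps the orbits in the ball of radius [c1 rho^(1/2)]; the sign [sg]
    accounts for both directions of time. *)
Lemma confinement (sg T : R) (z : R -> phase R N) :
  (forall t, 0 <= t <= T -> derivable z t 1) ->
  (forall t, 0 <= t <= T -> enorm (z t) <= c1 * s ->
     is_derive t 1 z (sg *: hamvf H (z t))) ->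
  enorm (z 0) <= 2 / 3 * s ->
  forall t, 0 <= t <= T -> enorm (z t) <= c1 * s.
Proof.
move=> zd zH z00 t tT.
have /andP[c1l c1u] := c1P.
have c1s : 0 <= c1 * s by rewrite mulr_ge0 ?(ltW s0) //; lra.
have le_sqr (a b : R) : 0 <= a -> 0 <= b -> (a <= b) = (a ^+ 2 <= b ^+ 2).
  by move=> a0 b0; rewrite ler_pXn2r.
have norm_sqr u : (enorm (z u) <= c1 * s) = (dot (z u) (z u) <= c1 ^+ 2 * rho).
  by rewrite le_sqr ?enorm_ge0 // enorm_sqr exprMn ss.
have z0_sqr : dot (z 0) (z 0) <= 4 / 9 * rho.
  rewrite -enorm_sqr -ss.
  have -> : 4 / 9 * s ^+ 2 = (2 / 3 * s) ^+ 2 by field.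
  by rewrite -le_sqr ?enorm_ge0 // mulr_ge0 // ltW.
have c1_sqr : 4 / 9 < c1 ^+ 2 by rewrite expr2; nra.
rewrite norm_sqr; apply/ltW.
apply: (@trap R (fun u => dot (z u) (z u)) _ T) tT.
- by apply: (le_lt_trans z0_sqr); rewrite ltr_pM2r.
- move=> u uT; have du : is_derive u 1 z ('D_1 z u) by split=> //; exact: zd.
  by have [] := is_derive_dot du.
move=> u /andP[u0 uT] below.
have inball (v : R) : 0 <= v <= u -> enorm (z v) <= c1 * s.
  by move=> /below; rewrite -norm_sqr.
have ball_s (v : R) : 0 <= v <= u -> enorm (z v) <= s.
  by move=> /inball h; apply: (le_trans h); rewrite ler_piMl ?(ltW s0).
have uu : 0 <= u <= u by rewrite u0 lexx.
have ou : 0 <= (0 : R) <= u by rewrite u0 lexx.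
have E : H (z u) = H (z 0).
  apply: (energy_conserved (s := sg) u0) => v vu.
    by apply/differentiable_H/cube_domain/ball_cube/ball_s.
  apply: zH; last exact: inball.
  by case/andP: vu => -> /le_trans; apply.
have := H_energy (ball_s u uu); have := H_energy (ball_s 0 ou).
rewrite E !ler_norml => /andP[a1 a2] /andP[b1 b2].
have Or : 4 * energy_const Czeta0 Ch1 Ctil * eps * rho
          < Omega N eps * (c1 ^+ 2 - 4 / 9) * rho by rewrite ltr_pM2r.
have Oz : Omega N eps * dot (z 0) (z 0) <= Omega N eps * (4 / 9 * rho).
  by rewrite ler_pM2l.
rewrite -(ltr_pM2l Omega0).
by move: Or Oz a1 a2 b1 b2; set O := Omega N eps; set A := energy_const _ _ _; lra.
Qed.

Let ball_rho z : enorm z <= c1 * s -> enorm z <= s.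
Proof.
by move=> h; apply: (le_trans h); rewrite ler_piMl ?(ltW s0) //; case/andP: c1P.
Qed.

Lemma XN_lipschitz z w : enorm z <= c1 * s -> enorm w <= c1 * s ->
  enorm (XN eps nf z - XN eps nf w) <= kap * rho * enorm (z - w).
Proof.
move=> zs ws; have /andP[c1l c1u] := c1P.
have seg t : 0 <= t <= 1 -> enorm (w + t *: (z - w)) <= c1 * s.
  move=> /andP[t0 t1].
  have -> : w + t *: (z - w) = (1 - t) *: w + t *: z.
    by rewrite scalerBr scalerBl scale1r addrCA addrC.
  apply: (le_trans (enormD_le _ _)); rewrite !enormZ !ger0_norm ?subr_ge0 //.
  have h1 : (1 - t) * enorm w <= (1 - t) * (c1 * s) by rewrite ler_wpM2l ?subr_ge0.
  have h2 : t * enorm z <= t * (c1 * s) by rewrite ler_wpM2l.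
  by lra.
have bound t : 0 <= t <= 1 -> differentiable (XN eps nf) (w + t *: (z - w)) /\
    forall v, enorm ('d (XN eps nf) (w + t *: (z - w)) v) <= kap * rho * enorm v.
  move=> t01; have hs := seg t t01.
  have rr : 0 < rho < rho_star N Czeta0 Ch1 eps by rewrite rho0 rho_star_gt.
  have [|d b] := XNb rr (cube_domain (ball_cube (ball_rho hs))).
    rewrite div1r powR12_sqrt ?(ltW rho0) //.
    by apply: (le_trans hs); rewrite ler_pM2r.
  split=> // v; apply: (le_trans (b v)); rewrite ler_wpM2r ?enorm_ge0 //.
  by rewrite mulrAC ler_pM2r.
by apply: mean_value_enorm => t /bound[].
Qed.

(** When [rho <= eps], each of the parts of [H] left out of [Keff] contributes
    [O(eps^2 rho^(1/2))]: the couplings of [Z_0] at distance at least 2 directly,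
    the couplings of [Z_1] through [eps rho^(3/2)], the remainder through
    [rho^(5/2)]. *)
Lemma residual_le w : enorm w <= s ->
  enorm (hamvf H w - hamvf K w) <= residual_const Czeta0 Ch1 Ctil * (eps ^+ 2 * s).
Proof.
move=> ws.
have Dw : D w by apply/cube_domain/ball_cube.
rewrite -hamvf_sub; [|exact: differentiable_H|exact: peval_differentiable].
pose pz : poly R N := cyc (\sum_(m < N.+1 | (2 <= m)%N) zeta0 N eps m).
pose pt : poly R N := cyc (\sum_(m < N.+1 | (1 <= m)%N) zeta1 nf m).
have Z0E : Z0 N eps = cyc (zeta0 N eps 1%N) + pz.
  rewrite Z0_tail /pz !cyc_sum (bigD1 (Ordinal (N1 : (1 < N.+1)%N))) //=.
  congr (_ + _); apply: eq_bigl => m; rewrite -val_eqE /=.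
  by case: (nat_of_ord m) => [|[|k]].
have Z1E : Z1 = cyc (zeta1 nf 0%N) + pt.
  rewrite /seed_sum /pt !cyc_sum (bigD1 ord0) //=.
  by congr (_ + _); apply: eq_bigl => m; rewrite lt0n -val_eqE.
have -> : H - K = peval pz + (peval pt + P2 eps nf).
  apply/funext => z; rewrite /H1nf /Keff Z0E Z1E !fctE !pevalD !fctE; ring.
have Lz : lips 1 (seed_factor * 2 * (Czeta0 * (2 * eps) ^+ 2)) (peval pz).
  by rewrite -seed_const; exact: (classD_lips (d := 1) (k := 2) zeta0D).
have Lt : lips 3 (seed_factor * 4 * (Ch1 * (2 * eps))) (peval pt).
  rewrite -seed_const -[X in Ch1 * X]expr1.
  exact: (classD_lips (d := 3) (k := 1) (nf_zeta1 NF)).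
pose k0 : R := seed_factor * (16 * Czeta0 + 64 * Ch1) + 32 * @P2_const R N Ch1 Ctil.
have k0_ge0 : 0 <= k0 by apply: addr_ge0; [apply: mulr_ge0 => //; exact: seed_factor_ge0|exact: mulr_ge0].
have k00 : 0 <= k0 * (eps ^+ 2 * s) by rewrite !mulr_ge0 ?sqr_ge0 // ltW.
rewrite /residual_const -/k0 -[X in _ <= X]mulrA.
apply: (hamvf_le (r := s)); [|exact: s0|exact: k00|].
  apply: differentiableD; first exact: peval_differentiable.
  apply: differentiableD; first exact: peval_differentiable.
  exact: (domain_P2 NF Dw).2.
move=> v d vw ds.
have d0 : 0 <= d by apply: (@radius_ge0 _ _ _ (v - w)) => i; rewrite !mxE.
have wi i : `|w 0 i| <= 2 * s by exact: ball_cube.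
have vi i : `|v 0 i| <= 2 * s.
  have -> : v 0 i = (v 0 i - w 0 i) + w 0 i by rewrite subrK.
  apply: (le_trans (ler_normD _ _)).
  have := vw i; have := le_trans (coord_le_enorm w i) ws; move: ds; lra.
have b1 := Lz.2 _ _ _ _ vi wi vw.
have b2 := Lt.2 _ _ _ _ vi wi vw.
have b3 : `|P2 eps nf v - P2 eps nf w| <= @P2_const R N Ch1 Ctil * (2 * s) ^+ 5 * d.
  apply: (P2_lipschitz Ctil0 NF _ Dw vi wi vw); first exact: cube_domain.
  by rewrite exprMn ss -natrX.
have -> : (peval pz + (peval pt + P2 eps nf)) v - (peval pz + (peval pt + P2 eps nf)) w
  = (peval pz v - peval pz w) + (peval pt v - peval pt w)
    + (P2 eps nf v - P2 eps nf w) by rewrite !fctE; ring.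
apply: (le_trans (ler_normD _ _)); apply: (le_trans (lerD (ler_normD _ _) (lexx _))).
apply: (le_trans (lerD (lerD b1 b2) b3)).
rewrite -!mulrDl ler_wpM2r //.
have er : rho * s * eps <= eps ^+ 2 * s.
  by rewrite mulrAC ler_wpM2r ?(ltW s0) // expr2 ler_pM2r.
have rr : rho ^+ 2 * s <= eps ^+ 2 * s.
  by rewrite ler_wpM2r ?(ltW s0) // lerXn2r ?nnegrE ?(ltW rho0) ?(ltW eps0).
have e1 : seed_factor * 4 * (Ch1 * (2 * eps)) * (2 * s) ^+ 3
          <= seed_factor * 64 * Ch1 * (eps ^+ 2 * s).
  have -> : seed_factor * 4 * (Ch1 * (2 * eps)) * (2 * s) ^+ 3
          = seed_factor * 64 * Ch1 * (rho * s * eps) by rewrite -ss; ring.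
  by rewrite ler_wpM2l // !mulr_ge0 ?seed_factor_ge0 // ltW.
have e2 : @P2_const R N Ch1 Ctil * (2 * s) ^+ 5
          <= 32 * @P2_const R N Ch1 Ctil * (eps ^+ 2 * s).
  have -> : @P2_const R N Ch1 Ctil * (2 * s) ^+ 5
          = 32 * @P2_const R N Ch1 Ctil * (rho ^+ 2 * s) by rewrite -ss; ring.
  by rewrite ler_wpM2l // mulr_ge0.
have e3 : seed_factor * 2 * (Czeta0 * (2 * eps) ^+ 2) * (2 * s) ^+ 1
          = seed_factor * 16 * Czeta0 * (eps ^+ 2 * s) by ring.
rewrite e3; apply: (le_trans (lerD (lerD (lexx _) e1) e2)).
by rewrite le_eqVlt; apply/orP; left; apply/eqP; rewrite /k0; ring.
Qed.

Lemma gauge_invariant_Keff : gauge_invariant (Keff eps nf).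
Proof.
apply: gauge_invariantD; first apply: gauge_invariantD.
- exact: gauge_invariant_HOmega.
- exact: gauge_invariant_cyc_zeta0.
rewrite (nf_Z1_leading NF); apply: gauge_invariantZ; apply: gauge_invariant_sum => j _.
have g : gauge_invariant ((2^-1 : R) *: (qvar R N j ^+ 2 + pvar R N j ^+ 2)).
  by rewrite !expr2; apply: gauge_invariantZ; exact: gauge_invariant_coupling.
by rewrite expr2; exact: gauge_invariantM.
Qed.

(** Gauge invariance makes the Euclidean norm a constant of motion. *)
Lemma Keff_norm_conserved (sg T : R) (w : R -> phase R N) :
  (forall t, 0 <= t <= T -> is_derive t 1 w (sg *: hamvf K (w t))) ->
  forall t, 0 <= t <= T -> enorm (w t) = enorm (w 0).
Proof.
move=> wd t /andP[t0 tT]; rewrite !enorm_dot; congr Num.sqrt.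
have nd (u : R) : 0 <= u <= t -> is_derive u 1 (fun u => dot (w u) (w u)) 0.
  move=> /andP[u0 ut]; have uT : 0 <= u <= T by rewrite u0 (le_trans ut).
  apply: (is_derive_eq (is_derive_dot (wd u uT))).
  by rewrite dotZr (gauge_invariant_dot _ gauge_invariant_Keff) !mulr0.
have nd01 (x : R) : x \in `]0, t[ -> is_derive x 1 (fun u => dot (w u) (w u)) 0.
  by rewrite in_itv /= => /andP[/ltW ? /ltW ?]; apply: nd; apply/andP.
have [c _ E] := MVT_segment t0 nd01 (is_derive_continuous_within nd).
by apply/eqP; rewrite -subr_eq0 E mul0r.
Qed.

Hypothesis eps_rho : eps ^+ 2 / rho <= c1 - 2 / 3.

(** In the equation of [z - w] the linear part is skew, the nonlinear field is
    Lipschitz, and the residual is small; hence Gronwall applies to the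
    Euclidean norm without loss in the exponent. *)
Lemma one_sided_estimate (sg T : R) (z w : R -> phase R N) :
  sg = 1 \/ sg = -1 -> 0 <= T ->
  (forall t, 0 <= t <= T -> is_derive t 1 z (sg *: hamvf H (z t))) ->
  (forall t, 0 <= t <= T -> is_derive t 1 w (sg *: hamvf K (w t))) ->
  enorm (z 0) <= 2 / 3 * s -> enorm (z 0 - w 0) <= eps ^+ 2 / s ->
  enorm (z T - w T) <= expR (kap * rho * T)
    * ((1 + residual_const Czeta0 Ch1 Ctil / kap) * (eps ^+ 2 / s)).
Proof.
move=> sgP T0 zd wd z00 zw0.
have zc : forall t, 0 <= t <= T -> enorm (z t) <= c1 * s.
  apply: (confinement (sg := sg)) z00 => t tT; first by case: (zd t tT).
  by move=> _; exact: zd.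
have wc t : 0 <= t <= T -> enorm (w t) <= c1 * s.
  move=> tT; rewrite (Keff_norm_conserved wd tT).
  have -> : w 0 = z 0 - (z 0 - w 0) by rewrite subKr.
  apply: (le_trans (enormD_le _ _)); rewrite enormN.
  apply: (le_trans (lerD z00 zw0)).
  have -> : eps ^+ 2 / s = eps ^+ 2 / rho * s.
    by rewrite -ss; field; rewrite gt_eqF.
  by rewrite -mulrDl ler_pM2r //; move: eps_rho; lra.
pose c := residual_const Czeta0 Ch1 Ctil * (eps ^+ 2 * s).
have c0' : 0 <= c.
  by apply: mulr_ge0; [exact: rc0|apply: mulr_ge0; [exact: sqr_ge0|exact: ltW]].
pose phi t := dot (z t - w t) (z t - w t).
pose dphi t := 2 * dot (z t - w t) (sg *: hamvf H (z t) - sg *: hamvf K (w t)).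
have phid t : 0 <= t <= T -> is_derive t 1 phi (dphi t).
  move=> tT; apply: (@is_derive_dot R N (fun t => z t - w t)).
  by have h1 := zd t tT; have h2 := wd t tT; exact: is_deriveB.
have sqrt_phi t : Num.sqrt (phi t) = enorm (z t - w t) by rewrite enorm_dot.
have bound t : 0 <= t <= T ->
    dphi t <= 2 * (kap * rho * phi t + c * Num.sqrt (phi t)).
  move=> tT; rewrite ler_pM2l // sqrt_phi /phi -enorm_sqr.
  set d := z t - w t.
  have Dz : D (z t) by apply/cube_domain/ball_cube/ball_rho/zc.
  have Dwt : D (w t) by apply/cube_domain/ball_cube/ball_rho/wc.
  have regroup (V : zmodType) (x y k a a' b b' l : V) :
      x = a + b -> y = a' + b' -> l = a - a' -> x - k = l + (b - b' + (y - k)).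
    by move=> -> yE ->; rewrite addrA (addrACA a) -opprD -yE subrKA.
  pose e := XN eps nf (z t) - XN eps nf (w t) + (hamvf H (w t) - hamvf K (w t)).
  have Hd : dot d (hamvf H (z t) - hamvf K (w t)) = dot d e.
    have split := regroup _ _ _ (hamvf K (w t)) _ _ _ _ _ (hamvf_H Dz) (hamvf_H Dwt)
      (hamvfB (z t) (w t) (linear_gradient_H0 eps)).
    apply: (etrans (congr1 (dot d) split)); apply: (etrans (dotDr _ _ _)).
    apply: (etrans (congr1 (+%R^~ _) (gauge_invariant_dot d (gauge_invariant_H0 eps)))).
    exact: add0r.
  have -> : dot d (sg *: hamvf H (z t) - sg *: hamvf K (w t)) = sg * dot d e.
    by rewrite -Hd -scalerBr dotZr.
  have eb : enorm e <= kap * rho * enorm d + c.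
    apply: (le_trans (enormD_le _ _)); apply: lerD.
      by apply: XN_lipschitz; [exact: zc|exact: wc].
    by apply: residual_le; apply: ball_rho; exact: wc.
  have : sg * dot d e <= enorm d * enorm e.
    case: sgP => ->; rewrite ?mul1r ?mulN1r; first exact: dot_le_enorm.
    by rewrite -dotNl -(enormN d); exact: dot_le_enorm.
  move=> /le_trans; apply.
  apply: (@le_trans _ _ (enorm d * (kap * rho * enorm d + c))).
    by rewrite ler_wpM2l // enorm_ge0.
  by rewrite le_eqVlt; apply/orP; left; apply/eqP; ring.
have kr0 : 0 < kap * rho by rewrite mulr_gt0.
have := gronwall_sqrt kr0 c0' T0 phid (fun t _ => dot_ge0 _) bound.
rewrite !sqrt_phi => /le_trans; apply.
rewrite ler_pM2l ?expR_gt0 //.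
have -> : c / (kap * rho) = residual_const Czeta0 Ch1 Ctil / kap * (eps ^+ 2 / s).
  by rewrite /c -ss; field; rewrite !gt_eqF.
by rewrite mulrDl mul1r lerD2r.
Qed.

(** The vector field of [H], frozen outside the cube, is globally Lipschitz; by
    confinement the global orbits of the frozen field issued from the ball
    never leave the region where it coincides with the field of [H]. *)
Lemma global_solution z0 : enorm z0 <= 2 / 3 * s ->
  exists z : R -> phase R N, z 0 = z0 /\
    forall t : R, enorm (z t) <= c1 * s /\ is_derive t 1 z (hamvf H (z t)).
Proof.
move=> z0s.
pose clip (a : R) := Num.max (- (2 * s)) (Num.min (2 * s) a).
have s2 : 0 < 2 * s by rewrite mulr_gt0.
have clip_le a : `|clip a| <= 2 * s.
  rewrite ler_norml /clip le_max lexx /= ge_max ge_min lexx /= andbT; lra.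
have clip_id a : `|a| <= 2 * s -> clip a = a.
  by rewrite ler_norml /clip => /andP[a1 a2]; rewrite min_r // max_r.
have clip_cases a : [\/ clip a = a /\ - (2 * s) <= a <= 2 * s,
    clip a = 2 * s /\ 2 * s <= a | clip a = - (2 * s) /\ a <= - (2 * s)].
  have [a1|a1] := leP a (2 * s); rewrite /clip.
    have [a2|a2] := leP (- (2 * s)) a.
      by apply: Or31; rewrite min_r // max_r.
    by apply: Or33; rewrite min_r // max_l ltW.
  apply: Or32; rewrite min_l ?(ltW a1) // max_r //; lra.
have clip_lip a b : `|clip a - clip b| <= `|a - b|.
  have W x y : x <= y -> `|clip x - clip y| <= `|x - y|.
    move=> xy; rewrite [leRHS]ler0_norm ?subr_le0 // ler_norml.
    by case: (clip_cases x) => -[-> ?]; case: (clip_cases y) => -[-> ?];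
      apply/andP; split; lra.
  by have [/W//|/ltW/W] := leP a b; rewrite distrC (distrC b).
pose proj z : phase R N := \row_i clip (z 0 i).
have proj_cube z i : `|proj z 0 i| <= 2 * s by rewrite mxE.
have proj_lip z w : enorm (proj z - proj w) <= n%:R * `|z - w|.
  apply: enorm_le_coord => // i; rewrite !mxE; apply: (le_trans (clip_lip _ _)).
  by have := coord_le_norm (z - w) i; rewrite !mxE.
pose Y z := hamvf H (proj z).
pose KX : R := C1 * Ch1 * (9 * n%:R ^+ 2 * rho) / (1 - (2 * eps) `^ (1 / 4)) ^+ 2.
have XNlip z w : enorm (XN eps nf (proj z) - XN eps nf (proj w))
    <= KX * enorm (proj z - proj w).
  have segE (a b : phase R N) (t : R) i :
      (a + t *: (b - a)) 0 i = (1 - t) * a 0 i + t * b 0 i by rewrite !mxE; ring.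
  have seg t : 0 <= t <= 1 -> forall i, `|(proj w + t *: (proj z - proj w)) 0 i| <= 2 * s.
    move=> /andP[t0 t1] i.
    have -> : (proj w + t *: (proj z - proj w)) 0 i
              = (1 - t) * proj w 0 i + t * proj z 0 i.
      exact: segE.
    apply: (le_trans (ler_normD _ _)); have t1' : 0 <= 1 - t by rewrite subr_ge0.
    rewrite !normrM (ger0_norm t0) (ger0_norm t1').
    have h1 : (1 - t) * `|proj w 0 i| <= (1 - t) * (2 * s).
      by rewrite ler_wpM2l ?subr_ge0.
    have h2 : t * `|proj z 0 i| <= t * (2 * s) by rewrite ler_wpM2l.
    by lra.
  have bound t : 0 <= t <= 1 ->
      differentiable (XN eps nf) (proj w + t *: (proj z - proj w)) /\
      forall v, enorm ('d (XN eps nf) (proj w + t *: (proj z - proj w)) v)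
                <= KX * enorm v.
    move=> /seg c; apply: (XNb big_rho (cube_domain c)).
    apply: (le_trans (cube_norm c)); rewrite ler_wpM2r ?powR_ge0 //.
    by case/andP: c1P => h _; apply: (le_trans (ltW h)).
  by apply: mean_value_enorm => t /bound[].
pose KH : R := Omega N eps * n%:R + seed_factor * 2 * (Czeta0 * (2 * eps)).
have KH0 : 0 <= KH.
  rewrite addr_ge0 ?mulr_ge0 ?seed_factor_ge0 // ?ltW //.
have H0lip : lips 1 KH (peval (H0 eps)).
  rewrite /H0 pevalD; apply: lipsD; last exact: lips_Z0.
  by apply: lips_HOmega; exact: ltW.
pose L : R := (n%:R * KH + `|KX|) * n%:R + 1.
have L0 : 0 < L by rewrite ltr_wpDl // !mulr_ge0 // addr_ge0 // mulr_ge0.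
have Ylip z w : `|Y z - Y w| <= L * `|z - w|.
  apply: norm_le_coord => [|i]; first by rewrite mulr_ge0 // ltW.
  apply: (le_trans (coord_le_enorm _ i)).
  rewrite /Y (hamvf_H (cube_domain (proj_cube z))) (hamvf_H (cube_domain (proj_cube w))).
  have -> : hamvf (peval (H0 eps)) (proj z) + XN eps nf (proj z)
      - (hamvf (peval (H0 eps)) (proj w) + XN eps nf (proj w))
    = hamvf (peval (H0 eps)) (proj z - proj w)
      + (XN eps nf (proj z) - XN eps nf (proj w)).
    by rewrite (hamvfB _ _ (linear_gradient_H0 eps)) opprD addrACA.
  apply: (le_trans (enormD_le _ _)).
  have h1 := hamvf_linear_le (proj z - proj w) KH0 H0lip.
  have h2 : enorm (XN eps nf (proj z) - XN eps nf (proj w))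
            <= `|KX| * enorm (proj z - proj w).
    by apply: (le_trans (XNlip z w)); rewrite ler_wpM2r ?enorm_ge0 // ler_norm.
  apply: (le_trans (lerD h1 h2)); rewrite mulrA -mulrDl.
  apply: (@le_trans _ _ ((n%:R * KH + `|KX|) * (n%:R * `|z - w|))).
    by rewrite ler_wpM2l // addr_ge0 // mulr_ge0.
  by rewrite mulrA ler_wpM2r // /L lerDl.
have [z [zz0 zY]] := picard_global z0 L0 Ylip.
exists z; split; first exact: zz0.
have YH (t : R) : enorm (z t) <= c1 * s -> Y (z t) = hamvf H (z t).
  move=> zt; congr hamvf; apply/rowP => i; rewrite mxE clip_id //.
  exact: (ball_cube (ball_rho zt)).
have zd (t : R) : is_derive t 1 z (Y (z t)) := zY t.
have conf (t : R) : enorm (z t) <= c1 * s.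
  have [t0|/ltW t0] := leP 0 t.
    apply: (confinement (sg := 1) (T := t) (z := z)).
    - by move=> u _; case: (zd u).
    - by move=> u _ zu; rewrite scale1r -YH.
    - by rewrite zz0.
    - by rewrite t0 lexx.
  have := @confinement (-1) (- t) (fun u => z (- u)).
  move=> /(_ _ _ _ (- t)); rewrite opprK; apply.
  - by move=> u _; case: (is_derive_reflect (zd (- u))).
  - by move=> u _ zu; rewrite scaleN1r -YH //; exact: is_derive_reflect.
  - by rewrite oppr0 zz0.
  - by rewrite oppr_ge0 t0 lexx.
by move=> t; split; [exact: conf|rewrite -YH].
Qed.

(** Time reversal changes the sign of both vector fields and reduces negative
    times to positive ones. *)
Lemma approximates_exp T bound : expR (kap * rho * T)
    * ((1 + residual_const Czeta0 Ch1 Ctil / kap) * (eps ^+ 2 / s)) <= bound ->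
  approximates Czeta0 Ch1 eps rho T bound nf.
Proof.
move=> Tb; rewrite /approximates div1r powR12_sqrt ?(ltW rho0) // -/s => z0 z0s.
split.
  have [z [zz0 zP]] := global_solution z0s.
  exists setT, z; split=> //; first by split=> //; exact: openT.
  move=> t _; have [zt zd] := zP t; split=> //.
  by apply/cube_domain/ball_cube/ball_rho.
move=> J z w [Jopen Jitv J0] zsol zz0 wsol zw0 t Jt tT.
have powN : rho `^ (- 2^-1) = s^-1 by rewrite powRN powR12_sqrt ?(ltW rho0).
have zw0' : enorm (z 0 - w 0) <= eps ^+ 2 / s by rewrite mulrC -powN.
have mono (u : R) : u <= T -> expR (kap * rho * u)
    * ((1 + residual_const Czeta0 Ch1 Ctil / kap) * (eps ^+ 2 / s)) <= bound.
  move=> uT; apply: le_trans Tb; rewrite ler_wpM2r //.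
    apply: mulr_ge0; last by rewrite divr_ge0 ?sqr_ge0 // ltW.
    by rewrite addr_ge0 // divr_ge0 // ltW.
  by rewrite ler_expR ler_pM2l // mulr_gt0.
have [t0|/ltW t0] := leP 0 t.
  have Ju u : 0 <= u <= t -> J u by move=> ut; apply: (Jitv 0 t).
  apply: le_trans (mono t _); last by rewrite ger0_norm in tT.
  apply: (one_sided_estimate (sg := 1)) => //.
  - by left.
  - by move=> u /Ju /zsol[_]; rewrite scale1r.
  - by move=> u /Ju /wsol[_]; rewrite scale1r.
  - by rewrite zz0.
have Ju u : 0 <= u <= - t -> J (- u).
  by move=> /andP[u0 ut]; apply: (Jitv t 0) => //; rewrite lerNr ut oppr_le0 u0.
apply: le_trans (mono (- t) _); last by rewrite ler0_norm in tT.
have := @one_sided_estimate (-1) (- t) (fun u => z (- u)) (fun u => w (- u)).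
rewrite !opprK !oppr0; apply => //.
- by right.
- by rewrite oppr_ge0.
- by move=> u /Ju /zsol[_ h]; rewrite scaleN1r; exact: is_derive_reflect.
- by move=> u /Ju /wsol[_ h]; rewrite scaleN1r; exact: is_derive_reflect.
- by rewrite zz0.
Qed.

End Dynamics.

End Chain.

(** * Choice of the constants *)

Lemma powR_lt1 (R : realType) (x p : R) : 0 <= x -> x < 1 -> 0 < p -> x `^ p < 1.
Proof.
move=> x0 x1 p0; have : x `^ p < 1 `^ p by apply: gt0_ltr_powR; rewrite ?nnegrE.
by rewrite powR1.
Qed.

Section Thresholds.
Context {R : realType} {N : nat}.
Variables (Czeta0 Ch1 eps : R).
Hypothesis eps0 : 0 < eps.
Hypothesis eps12 : 2 * eps < 1.
Hypothesis Cz0 : 0 < Czeta0.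
Hypothesis Ch0 : 0 < Ch1.
Hypothesis f1 : 1 < f_thr N Czeta0 eps.

Let q : R := Num.sqrt (2 * eps).
Let a : R := (1 - 2 * eps) * (1 - (2 * eps) `^ (3 / 4)).

Let q0 : 0 < q. Proof. by rewrite sqrtr_gt0 mulr_gt0. Qed.

Let a01 : 0 < a <= 1.
Proof.
have e0 : 0 <= 2 * eps by rewrite mulr_ge0 // ltW.
have p1 : (2 * eps) `^ (3 / 4) < 1.
  by apply: powR_lt1 => //; lra.
have p0 : 0 <= (2 * eps) `^ (3 / 4) by exact: powR_ge0.
by rewrite /a mulr_gt0 ?subr_gt0 //= mulr_ile1 ?subr_ge0 ?gerBl // ltW.
Qed.

Let f_bound : 64 * Czeta0 * q < 3 * Omega N eps * a.
Proof.
have := f1; rewrite /f_thr -/a -/q.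
have -> : 3 * Omega N eps / (64 * Czeta0) * (a / q)
          = (3 * Omega N eps * a) / (64 * Czeta0 * q).
  by field; rewrite !gt_eqF.
by rewrite ltr_pdivlMr ?mulr_gt0 // mul1r.
Qed.

(** By definition of the threshold, [f > 1] compares [Omega] with
    [sqrt (2 eps)]. *)
Lemma Omega_lower_bound : 21 * Czeta0 * q < Omega N eps.
Proof.
have /andP[a0 a1] := a01.
have Cq : 0 < Czeta0 * q by rewrite mulr_gt0.
have Om : 0 < Omega N eps.
  rewrite ltNge; apply/negP => Om; have := f_bound.
  have : 3 * Omega N eps * a <= 0 by rewrite mulr_le0_ge0 ?(ltW a0) //; lra.
  by lra.
have : 3 * Omega N eps * a <= 3 * Omega N eps by rewrite ler_piMr // mulr_ge0 // ltW.
by have := f_bound; lra.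
Qed.

(** This uses [gamma >= Omega], which also follows from [f > 1]. *)
Lemma rho_star_lower_bound :
  Czeta0 * q / (6 * (1 + expR 1) * Ch1) <= rho_star N Czeta0 Ch1 eps.
Proof.
have /andP[a0 a1] := a01.
have Om : 0 < Omega N eps.
  by apply: lt_trans Omega_lower_bound; rewrite !mulr_gt0.
have f0 : 0 < f_thr N Czeta0 eps by apply: lt_trans f1.
have gO : Omega N eps <= gamma N Czeta0 eps.
  have h : 1 / (2 * f_thr N Czeta0 eps) <= 1 / 2.
    have p2 : 0 < 2 * f_thr N Czeta0 eps by apply: mulr_gt0.
    by rewrite ler_pdivrMr // mulrA div1r mulVf ?pnatr_eq0 // mul1r ltW.
  have := ler_wpM2l (ltW Om) h; rewrite /gamma; set X := 1 / (2 * f_thr _ _ _); lra.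
have g0 := lt_le_trans Om gO.
have e0 : 0 < 1 + expR 1 :> R by rewrite addr_gt0 // expR_gt0.
have CE : Cstar N Czeta0 Ch1 eps = 4 * Ch1 / (3 * gamma N Czeta0 eps * a).
  by rewrite /Cstar /a; congr (_ / _); ring.
have ga0 : 0 < 3 * gamma N Czeta0 eps * a.
  by apply: mulr_gt0 a0; exact: mulr_gt0.
have Cs0 : 0 < Cstar N Czeta0 Ch1 eps
  by rewrite CE; apply: divr_gt0; [exact: mulr_gt0|].
have d0 : 0 < 96 * (1 + expR 1) * Cstar N Czeta0 Ch1 eps.
  by apply: mulr_gt0 Cs0; exact: mulr_gt0.
rewrite /rho_star ler_pdivlMr // CE.
have -> : Czeta0 * q / (6 * (1 + expR 1) * Ch1)
    * (96 * (1 + expR 1) * (4 * Ch1 / (3 * gamma N Czeta0 eps * a)))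
  = (64 * Czeta0 * q) / (3 * gamma N Czeta0 eps * a).
  field; rewrite !gt_eqF //.
rewrite ler_pdivrMr // mul1r; apply: (le_trans (ltW f_bound)).
by rewrite ler_pM2r // ler_pM2l.
Qed.

End Thresholds.

Lemma kappa0_gt0 (R : realType) (Ch1 C1 eps : R) :
  0 < Ch1 -> 0 < C1 -> 0 < eps -> eps < 1 / 2 -> 0 < kappa0 Ch1 C1 eps.
Proof.
move=> Ch0 C0 e0 e1; have p1 : (2 * eps) `^ (1 / 4) < 1 by apply: powR_lt1; lra.
by apply: divr_gt0; [exact: mulr_gt0|rewrite exprn_gt0 // subr_gt0].
Qed.

Lemma kappa0_mono (R : realType) (Ch1 C1 eps eps_star : R) :
  0 < Ch1 -> 0 < C1 -> 0 < eps -> eps < eps_star -> eps_star < 1 / 2 ->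
  kappa0 Ch1 C1 eps <= kappa0 Ch1 C1 eps_star.
Proof.
move=> Ch0 C0 e0 ee es; have es0 := lt_trans e0 ee.
have p1 : (2 * eps_star) `^ (1 / 4) < 1.
  by apply: powR_lt1; lra.
have p2 : (2 * eps) `^ (1 / 4) <= (2 * eps_star) `^ (1 / 4).
  by apply: ge0_ler_powR => //; rewrite ?nnegrE //; lra.
have C : 0 < C1 * Ch1 by rewrite mulr_gt0.
rewrite /kappa0 ler_pM2l // lef_pV2 ?posrE ?exprn_gt0 //; try lra.
by rewrite lerXn2r ?nnegrE; lra.
Qed.

(** The estimate of which both regimes are special cases: up to a constant, the
    initial error and the residual are amplified by [exp (kappa0 rho T)]. *)
Lemma uniform_estimate (R : realType) (N : nat)
    (Czeta0 Ch1 Ctil eps_star C1 c0 : R) (nf : R -> nf_data R N) :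
  (1 <= N)%N -> 0 < eps_star < 1 / 2 -> 0 < Ctil -> 0 < C1 -> 2 / 3 < c0 ->
  (forall eps, 0 < eps < eps_star -> classD 2 Czeta0 (2 * eps) (zeta0 N eps)) ->
  (forall eps, 0 < eps < eps_star -> 1 < f_thr N Czeta0 eps) ->
  (forall eps, 0 < eps < eps_star -> normal_form Czeta0 Ch1 Ctil eps (nf eps)) ->
  (forall eps, 0 < eps < eps_star ->
     XN_differential_bound Czeta0 Ch1 C1 c0 eps (nf eps)) ->
  exists eta C : R, [/\ 0 < eta, eta <= 1, 0 < C &
    forall eps rho T bound : R, 0 < eps < eps_star -> 0 < rho ->
      eps ^+ 2 / rho < eta -> rho <= eps ->
      expR (kappa0 Ch1 C1 eps_star * rho * T)
        * (C * (eps ^+ 2 / Num.sqrt rho)) <= bound ->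
      approximates Czeta0 Ch1 eps rho T bound (nf eps)].
Proof.
move=> hN /andP[es0 es1] Ctil0 C10 hc0 hz hf hnf hX.
have half : 0 < eps_star / 2 < eps_star by lra.
have Cz0 : 0 < Czeta0 by have [] := hz _ half.
have Ch0 : 0 < Ch1 := Ch1_gt0 (hnf _ half).
pose n : R := (sites N + sites N)%N%:R.
have n0 : 0 < n by rewrite ltr0n.
pose c1 := Num.min c0 1.
have c1P : 2 / 3 < c1 <= 1 by rewrite lt_min hc0 ge_min lexx orbT andbT /=; lra.
have c1c0 : c1 <= c0 by rewrite ge_min lexx.
have c1sq : 0 < c1 ^+ 2 - 4 / 9 by move/andP: c1P => [? _]; rewrite expr2; nra.
have e0 : 0 < 1 + expR 1 :> R by rewrite addr_gt0 // expR_gt0.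
pose A : R := @energy_const R N Czeta0 Ch1 Ctil.
have P20 : 0 <= @P2_const R N Ch1 Ctil by rewrite /P2_const !mulr_ge0 // ltW.
have A0 : 0 <= A.
  rewrite /A /energy_const addr_ge0 // mulr_ge0 ?seed_factor_ge0 //.
  by rewrite addr_ge0 // mulr_ge0 // ltW.
pose B : R := @residual_const R N Czeta0 Ch1 Ctil.
have B0 : 0 <= B.
  rewrite /B /residual_const mulr_ge0 // addr_ge0 //; last by rewrite mulr_ge0.
  rewrite mulr_ge0 ?seed_factor_ge0 //.
  by rewrite addr_ge0 // mulr_ge0 // ltW.
pose kap := kappa0 Ch1 C1 eps_star.
have kap0 : 0 < kap by exact: kappa0_gt0.
(* With q = sqrt(2 eps) one has rho <= eps = q^2 / 2, whereas Omega and rho_star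
   are at least of order q: each smallness condition becomes an upper bound on
   q. These bounds serve, in this order, to keep the cube of half-side
   2 sqrt(rho) in the domain, to sum the remainder, and to confine the orbits. *)
pose q1 : R := Czeta0 / (27 * n ^+ 2 * (1 + expR 1) * Ch1).
pose q2 : R := 1 / (8 * Ctil).
pose q3 : R := 21 * Czeta0 * (c1 ^+ 2 - 4 / 9) / (2 * A + 1).
have q10 : 0 < q1 by rewrite divr_gt0 // !mulr_gt0 // exprn_gt0.
have q20 : 0 < q2 by rewrite divr_gt0 // mulr_gt0.
have A10 : 0 < 2 * A + 1 by lra.
have q30 : 0 < q3 by rewrite divr_gt0 // !mulr_gt0.
pose q0 : R := Num.min q1 (Num.min q2 q3).
have q00 : 0 < q0 by rewrite !lt_min q10 q20.
pose eta : R := Num.min 1 (Num.min (q0 ^+ 2 / 2) (c1 - 2 / 3)).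
have eta0 : 0 < eta.
  rewrite !lt_min ltr01 divr_gt0 ?exprn_gt0 //=; lra.
exists eta, (1 + B / kap); split=> //.
- by rewrite ge_min lexx.
- by rewrite ltr_wpDr // divr_ge0 // ltW.
move=> eps rho T bound /andP[eps0 epss] rho0 er re Tb.
have epsI : 0 < eps < eps_star by rewrite eps0.
have eps_er : eps <= eps ^+ 2 / rho by rewrite ler_pdivlMr // expr2 ler_pM2l.
have : eps < eta := le_lt_trans eps_er er.
rewrite /eta !lt_min => /and3P[_ epsq _].
have /ltW : eps ^+ 2 / rho < c1 - 2 / 3.
  by move: er; rewrite /eta !lt_min => /and3P[].
move=> erc.
have eps12 : 2 * eps < 1 by lra.
pose q : R := Num.sqrt (2 * eps).
have q_0 : 0 < q by rewrite sqrtr_gt0 mulr_gt0.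
have qq : q ^+ 2 = 2 * eps by rewrite sqr_sqrtr // mulr_ge0 // ltW.
have : q < q0.
  rewrite -(@ltr_pXn2r _ 2) ?nnegrE ?(ltW q_0) ?(ltW q00) // qq.
  by move: epsq; rewrite ltr_pdivlMr //; lra.
rewrite /q0 !lt_min => /and3P[qq1 qq2 qq3].
have q_1 : q <= 1.
  by rewrite -(@ler_pXn2r _ 2) ?nnegrE ?(ltW q_0) // qq expr1n ltW.
have Om := Omega_lower_bound eps0 eps12 Cz0 (hf _ epsI).
have rs := rho_star_lower_bound eps0 eps12 Cz0 Ch0 (hf _ epsI).
have Om0 : 0 < Omega N eps by apply: lt_trans Om; rewrite !mulr_gt0.
have eq : eps = q * q / 2 by rewrite -expr2 qq; field.
apply: (@approximates_exp R N Czeta0 Ch1 Ctil C1 c0 c1 kap) => //.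
- exact: hnf.
- exact: hX.
- exact: hz.
- apply: lt_le_trans rs; rewrite -/n -/q ltr_pdivlMr ?mulr_gt0 //.
  move: qq1; rewrite /q1 ltr_pdivlMr ?mulr_gt0 ?exprn_gt0 // => qq1.
  apply: (@le_lt_trans _ _ (q * (q * (27 * n ^+ 2 * (1 + expR 1) * Ch1)))).
    have -> : q * (q * (27 * n ^+ 2 * (1 + expR 1) * Ch1))
        = 9 * n ^+ 2 * eps * (6 * (1 + expR 1) * Ch1) by rewrite eq; field.
    rewrite ler_pM2r ?mulr_gt0 // ler_pM2l // mulr_gt0 // exprn_gt0 //.
  by rewrite [ltRHS]mulrC ltr_pM2l.
- move: qq2; rewrite /q2 ltr_pdivlMr ?mulr_gt0 // => qq2.
  apply: (@le_trans _ _ (Ctil * (4 * eps))); first by rewrite !ler_pM2l.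
  have : q * (q * (8 * Ctil)) <= 1 * 1 by apply: ler_pM; rewrite ?mulr_ge0 // ltW.
  by rewrite eq; lra.
- rewrite -/A; move: qq3; rewrite /q3 ltr_pdivlMr // => qq3.
  apply: (@lt_trans _ _ (21 * Czeta0 * q * (c1 ^+ 2 - 4 / 9))); last by rewrite ltr_pM2r.
  have : q * (q * (2 * A + 1)) < q * (21 * Czeta0 * (c1 ^+ 2 - 4 / 9)).
    by rewrite ltr_pM2l.
  have : 0 < q * q by rewrite mulr_gt0.
  by rewrite eq; lra.
- exact: kappa0_mono Ch0 C10 eps0 epss es1.
Qed.

Theorem theorem6 (R : realType) (N : nat)
  (Czeta0 Ch1 Ctil eps_star C1 c0 : R) (nf : R -> nf_data R N)
  (hN : (1 <= N)%N)
  (heps_star : 0 < eps_star < 1 / 2)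
  (hCtil : 0 < Ctil) (hC1 : 0 < C1) (hc0 : 2 / 3 < c0)
  (hzeta0 : forall eps, 0 < eps < eps_star ->
     classD 2 Czeta0 (2 * eps) (zeta0 N eps))
  (hh1 : forall eps, 0 < eps < eps_star ->
     exists h1 : seed R N,
       classD 4 Ch1 (2 * eps) h1 /\ to_qp eps (H1xy R N) = cyc (seed_sum h1))
  (hf : forall eps, 0 < eps < eps_star -> 1 < f_thr N Czeta0 eps)
  (hnf : forall eps, 0 < eps < eps_star ->
     normal_form Czeta0 Ch1 Ctil eps (nf eps))
  (hXN : forall eps, 0 < eps < eps_star ->
     XN_differential_bound Czeta0 Ch1 C1 c0 eps (nf eps)) :
  (exists eta C : R, [/\ 0 < eta, 0 < C &
     forall eps rho : R,
       0 < eps < eps_star -> 0 < rho < rho_star N Czeta0 Ch1 eps ->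
       eps ^+ 2 / rho < eta -> rho <= eps ->
       approximates Czeta0 Ch1 eps rho (1 / rho)
         (C * rho `^ (- (1 / 2)) * eps ^+ 2) (nf eps)])
  /\
  (forall alpha : R, 0 < alpha < 1 ->
   exists eta C : R, [/\ 0 < eta, 0 < C &
     forall eps rho : R,
       0 < eps < eps_star -> 0 < rho < rho_star N Czeta0 Ch1 eps ->
       eps `^ (2 / (1 + alpha)) / rho < eta -> rho <= eps ->
       approximates Czeta0 Ch1 eps rho
         (alpha / (kappa0 Ch1 C1 eps_star * rho) * ln (1 / rho))
         (C * rho `^ (- (1 / 2) - alpha) * eps ^+ 2) (nf eps)]).
Proof.
have [eta [C [eta0 eta1 C0 H]]] :=
  uniform_estimate hN heps_star hCtil hC1 hc0 hzeta0 hf hnf hXN.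
have /andP[es0 es1] := heps_star.
have half : 0 < eps_star / 2 < eps_star by lra.
have kap0 : 0 < kappa0 Ch1 C1 eps_star.
  by apply: kappa0_gt0 => //; exact: Ch1_gt0 (hnf _ half).
have powN (rho : R) : 0 < rho -> rho `^ (- (1 / 2)) = (Num.sqrt rho)^-1.
  by move=> r0; rewrite powRN div1r powR12_sqrt ?(ltW r0).
split=> [|alpha /andP[al0 al1]].
  exists eta, (expR (kappa0 Ch1 C1 eps_star) * C); split=> //.
    by rewrite mulr_gt0 ?expR_gt0.
  move=> eps rho epsI /andP[rho0 _] er re; apply: H => //.
  have -> : kappa0 Ch1 C1 eps_star * rho * (1 / rho) = kappa0 Ch1 C1 eps_star.
    by field; rewrite gt_eqF.
  by rewrite powN // le_eqVlt; apply/orP; left; apply/eqP; ring.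
exists eta, C; split=> // eps rho epsI /andP[rho0 _] er re.
have /andP[eps0 epss] := epsI.
have eps1 : eps <= 1 by lra.
apply: H => //.
  (* As 2 / (1 + alpha) < 2 and eps < 1, the second regime lies in the first. *)
  apply: le_lt_trans er; rewrite ler_pM2r ?invr_gt0 // -powR_mulrn ?(ltW eps0) //.
  apply: ger_powR; first by rewrite eps0.
  by rewrite ler_pdivrMr; lra.
have -> : kappa0 Ch1 C1 eps_star * rho
    * (alpha / (kappa0 Ch1 C1 eps_star * rho) * ln (1 / rho)) = - alpha * ln rho.
  rewrite div1r lnV ?posrE //; field; rewrite !gt_eqF //.
have -> : expR (- alpha * ln rho) = rho `^ (- alpha) by rewrite /powR gt_eqF.
rewrite powRD; last by apply/implyP => _; rewrite gt_eqF.
by rewrite powN // le_eqVlt; apply/orP; left; apply/eqP; ring.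
Qed.
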